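(* Suppose that one of the following holds: (a) $R$ is a $\mathbb{Z}^n$ standard graded $k$-subalgebra of $k[x_1,\ldots,x_n]$; or (b) $(R,\mathfrak{m})$ is a one-dimensional analytically irreducible residually rational ring whose maximal ideal has the form $\mathfrak{m}=(t^{n_1},\ldots,t^{n_e})$ for some $t\in\overline{R}$. Let $I$ and $J$ be finitely generated monomial fractional ideals of $R$, and let $I=(a_1,\ldots,a_h)$ where each $a_i$ is a monomial. Then the following conditions are equivalent: (1) $\mathrm{T}(I\otimes_R J)=0$; (2) $(P\cap Q)J=PJ\cap QJ$ for all fractional ideals $P$ and $Q$ (not necessarily monomial) such that $P+Q=I$; (3) $\big((a_i\mid i\in\mathcal{S})\cap(a_j\mid j\notin\mathcal{S})\big)J=(a_i\mid i\in\mathcal{S})J\cap(a_j\mid j\notin\mathcal{S})J$ for all subsets $\mathcal{S}\subset\{1,\ldots,h\}$.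
   Context: $R$ is a commutative domain with field of fractions $K$, and $\overline{R}$ is the integral closure of $R$ in $K$. For an $R$-module $M$, $\mathrm{T}(M)=\{x\in M : rx=0\text{ for some nonzero } r\in R\}$ is its torsion submodule. A fractional ideal of $R$ is a finitely generated $R$-submodule of $K$; $I$ and $J$ are nonzero. $(c_i\mid i\in\mathcal{S})$ denotes the $R$-submodule of $K$ generated by the $c_i$. Case (a): $k$ is a field, and a $\mathbb{Z}^n$ standard graded $k$-subalgebra of $k[x_1,\ldots,x_n]$ is a $k$-subalgebra that is homogeneous for the $\mathbb{Z}^n$-grading in which $x_i$ has degree the $i$-th standard basis vector, i.e. it is spanned over $k$ by the monomials it contains. A monomial is an element $x^w=\prod x_i^{w_i}\in K$ with $w\in\mathbb{Z}^n$, and a monomial fractional ideal is one generated by monomials. Case (b): Local rings are Noetherian. A local ring is analytically irreducible if its completion is a domain. An analytically irreducible local ring is residually rational if it has the same residue field as its integral closure (which is then local; in dimension one it is a discrete valuation ring). Here a monomial is an integer power $t^z$, $z\in\mathbb{Z}$, of the fixed element $t$, and a monomial fractional ideal is one of the form $(t^{z_1},\ldots,t^{z_h})$ with $z_1,\ldots,z_h\in\mathbb{Z}$. *)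

(* Defs.v *)
From HB Require Import structures.
From mathcomp Require Import all_boot all_order all_algebra.
From mathcomp Require Import generic_quotient ring_quotient.
From mathcomp Require Import boolp classical_sets functions.
From mathcomp Require Import freeg mpoly.

Set Implicit Arguments.
Unset Strict Implicit.
Unset Printing Implicit Defensive.

Import GRing.Theory.
Local Open Scope ring_scope.
Local Open Scope quotient_scope.

(* Submodules are boolean predicates, the library's [submodClosed V]; boolean
   membership is obtained from propositions by [asbool].  Equality of
   submodules is extensional equality [=i]. *)

Section Span.
Variables (R : comNzRingType) (V : lmodType R).

Definition lspan (A : {pred V}) : {pred V} := fun v =>
  `[< exists n (c : 'I_n -> R) (a : 'I_n -> V),
        (forall i, a i \in A) /\ v = \sum_i c i *: a i >].

Lemma lspanP (A : {pred V}) v :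
  reflect (exists n (c : 'I_n -> R) (a : 'I_n -> V),
             (forall i, a i \in A) /\ v = \sum_i c i *: a i) (v \in lspan A).
Proof. exact: asboolP. Qed.

Lemma lspan_submod_closed A : submod_closed (lspan A).
Proof.
split=> [|r u v /lspanP[n [c [a [aA ->]]]] /lspanP[p [d [b [bA ->]]]]].
  apply/lspanP; exists 0, (fun=> 0), (fun=> 0).
  by split=> [[]//|]; rewrite big_ord0.
apply/lspanP; exists (n + p)%N.
exists (fun i : 'I_(n + p) => match fintype.split i with inl j => r * c j | inr j => d j end).
exists (fun i : 'I_(n + p) => match fintype.split i with inl j => a j | inr j => b j end).
split=> [i|]; first by case: (fintype.split i).
rewrite big_split_ord scaler_sumr /=; congr (_ + _); apply: eq_bigr => i _.
  by rewrite -[lshift _ _]/(unsplit (inl i)) unsplitK scalerA.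
by rewrite -[rshift _ _]/(unsplit (inr i)) unsplitK.
Qed.

HB.instance Definition _ A :=
  GRing.isSubmodClosed.Build R V (lspan A) (lspan_submod_closed A).

Definition span_seq (s : seq V) : {pred V} := lspan (mem s).
HB.instance Definition _ s := GRing.SubmodClosed.on (span_seq s).

Definition fin_gen (N : {pred V}) : Prop := exists s : seq V, N =i span_seq s.

Definition addmod (M N : {pred V}) : {pred V} := fun v =>
  `[< exists x y, [/\ x \in M, y \in N & v = x + y] >].

End Span.

Definition mulmod (R : comNzRingType) (A : comAlgType R) (M N : {pred A}) :
  {pred A} :=
  lspan (fun v => `[< exists x y, [/\ x \in M, y \in N & v = x * y] >]).

HB.instance Definition _ (R : comNzRingType) (A : comAlgType R)
  (M N : {pred A}) := GRing.SubmodClosed.on (mulmod M N).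

Section QuotientModule.
Variables (R : comNzRingType) (V : lmodType R) (N : submodClosed V).

(* [submodClosed V] does not inherit from [zmodClosed V], because it is also
   defined for semimodules. *)
Definition zsubmod : {pred V} := N.

Lemma zsubmod_zmod_closed : zmod_closed zsubmod.
Proof.
split=> [|x y xN yN]; first exact: (rpred0 N).
by rewrite -scaleN1r; apply: (rpredD xN); apply: (rpredZ (-1)).
Qed.

HB.instance Definition _ :=
  GRing.isZmodClosed.Build V zsubmod zsubmod_zmod_closed.

Definition quotmod : Type := {ideal_quot zsubmod}.
HB.instance Definition _ := GRing.Zmodule.on quotmod.

Definition quotmod_pi (v : V) : quotmod := \pi_{ideal_quot zsubmod} v.

Definition quotmod_scale (r : R) (x : quotmod) : quotmod :=
  quotmod_pi (r *: repr (x : {ideal_quot zsubmod})).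

Lemma quotmod_scale_pi r v :
  quotmod_scale r (quotmod_pi v) = quotmod_pi (r *: v).
Proof.
apply/eqP; rewrite /quotmod_scale /quotmod_pi -Quotient.idealrBE.
rewrite -scalerBr; apply: (@rpredZ _ _ N).
by rewrite -[_ \in _]/(_ \in zsubmod) Quotient.idealrBE reprK.
Qed.

Lemma quotmod_piD u v : quotmod_pi (u + v) = quotmod_pi u + quotmod_pi v.
Proof. exact: raddfD. Qed.

Lemma quotmodP (x : quotmod) : exists v, x = quotmod_pi v.
Proof. by exists (repr (x : {ideal_quot zsubmod})); rewrite /quotmod_pi reprK. Qed.

Lemma quotmod_scaleA a b x :
  quotmod_scale a (quotmod_scale b x) = quotmod_scale (a * b) x.
Proof. by have [v ->] := quotmodP x; rewrite !quotmod_scale_pi scalerA. Qed.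

Lemma quotmod_scale1 : left_id 1 quotmod_scale.
Proof. by move=> x; have [v ->] := quotmodP x; rewrite quotmod_scale_pi scale1r. Qed.

Lemma quotmod_scaleDr : right_distributive quotmod_scale +%R.
Proof.
move=> a x y; have [u ->] := quotmodP x; have [v ->] := quotmodP y.
by rewrite -quotmod_piD !quotmod_scale_pi scalerDr quotmod_piD.
Qed.

Lemma quotmod_scaleDl x : {morph quotmod_scale^~ x : a b / a + b}.
Proof.
move=> a b; have [v ->] := quotmodP x.
by rewrite !quotmod_scale_pi scalerDl quotmod_piD.
Qed.

HB.instance Definition _ := GRing.Zmodule_isLmodule.Build R quotmod
  quotmod_scaleA quotmod_scale1 quotmod_scaleDr quotmod_scaleDl.

End QuotientModule.

Section Tensor.
Variables (R : comNzRingType) (M N : lmodType R).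

Local Notation free := {freeg (M * N)%type / R}.
Local Notation "[ x , y ]" := (<< (x, y) >> : free).

Variant tensor_relator : free -> Prop :=
| RelDl x x' y : tensor_relator ([x + x', y] - [x, y] - [x', y])
| RelDr x y y' : tensor_relator ([x, y + y'] - [x, y] - [x, y'])
| RelZl r x y : tensor_relator ([r *: x, y] - r *: [x, y])
| RelZr r x y : tensor_relator ([x, r *: y] - r *: [x, y]).

Definition tensor_rels : {pred free} := lspan (fun u => `[< tensor_relator u >]).
HB.instance Definition _ := GRing.SubmodClosed.on tensor_rels.

Definition tensor : Type := quotmod tensor_rels.
HB.instance Definition _ := GRing.Lmodule.on tensor.

Definition tens (x : M) (y : N) : tensor := quotmod_pi tensor_rels [x, y].

End Tensor.

Section Submodule.
Variables (R : comNzRingType) (V : lmodType R) (N : submodClosed V).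

Definition submod_type : Type := {v : V | v \in N}.
HB.instance Definition _ := SubChoice.on submod_type.
HB.instance Definition _ := [SubChoice_isSubLmodule of submod_type by <:].

End Submodule.

Definition torsion (R : idomainType) (M : lmodType R) : {pred M} := fun x =>
  `[< exists2 r : R, r != 0 & r *: x = 0 >].
Arguments torsion {R} M.

Section FractionAlgebra.
Variable R : idomainType.
Local Notation K := {fraction R}.

Definition frac_scale (r : R) (x : K) : K := tofrac r * x.

Lemma frac_scaleA a b x : frac_scale a (frac_scale b x) = frac_scale (a * b) x.
Proof. by rewrite /frac_scale tofracM mulrA. Qed.

Lemma frac_scale1 : left_id 1 frac_scale.
Proof. by move=> x; rewrite /frac_scale tofrac1 mul1r. Qed.

Lemma frac_scaleDr : right_distributive frac_scale +%R.
Proof. by move=> a x y; rewrite /frac_scale mulrDr. Qed.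

Lemma frac_scaleDl x : {morph frac_scale^~ x : a b / a + b}.
Proof. by move=> a b; rewrite /frac_scale tofracD mulrDl. Qed.

HB.instance Definition _ := GRing.Zmodule_isLmodule.Build R K
  frac_scaleA frac_scale1 frac_scaleDr frac_scaleDl.

Lemma frac_scaleAl (a : R) (x y : K) : a *: (x * y) = (a *: x) * y.
Proof. exact: mulrA. Qed.

HB.instance Definition _ := GRing.Lmodule_isLalgebra.Build R K frac_scaleAl.
HB.instance Definition _ := GRing.Lalgebra_isComAlgebra.Build R K.

End FractionAlgebra.

Section IntegralClosure.
Variable R : idomainType.
Local Notation K := {fraction R}.

Definition integral_over : {pred K} := fun x => `[< integralOver (@tofrac R) x >].

Lemma integral_overP x :
  reflect (integralOver (@tofrac R) x) (x \in integral_over).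
Proof. exact: asboolP. Qed.

Lemma integral_over_subring_closed : subring_closed integral_over.
Proof.
split=> [|x y /integral_overP xi /integral_overP yi|
          x y /integral_overP xi /integral_overP yi]; apply/integral_overP.
- exact: integral1.
- exact: integral_sub.
- exact: integral_mul.
Qed.

HB.instance Definition _ :=
  GRing.isSubringClosed.Build K integral_over integral_over_subring_closed.

Definition int_closure : Type := {x : K | x \in integral_over}.
HB.instance Definition _ := SubChoice.on int_closure.
HB.instance Definition _ := [SubChoice_isSubComNzRing of int_closure by <:].

Lemma integral_over_tofrac (r : R) : tofrac r \in integral_over.
Proof. by apply/integral_overP; exact: integral_id. Qed.

Definition to_int_closure (r : R) : int_closure :=
  exist _ (tofrac r) (integral_over_tofrac r).

End IntegralClosure.

(* [idealr R] and [prime_idealr R] are the proper and the prime ideals of R,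
   whereas [submodClosed R^o] also contains the unit ideal. *)
Section LocalRings.
Variable R : comNzRingType.

Definition noetherian : Prop := forall I : submodClosed R^o, fin_gen I.

Definition maximal_ideal (m : idealr R) : Prop :=
  forall I : idealr R, {subset m <= I} -> I =i m.

Definition local_ring (m : idealr R) : Prop :=
  [/\ noetherian, maximal_ideal m
    & forall m' : idealr R, maximal_ideal m' -> m' =i m].

Definition prime_chain (d : nat) : Prop :=
  exists P : 'I_d.+1 -> prime_idealr R, forall i j : 'I_d.+1, (i < j)%N ->
    {subset P i <= P j} /\ ~ {subset P j <= P i}.

Definition krull_dim_eq (d : nat) : Prop := prime_chain d /\ ~ prime_chain d.+1.

End LocalRings.

(* The m-adic completion: Cauchy sequences modulo null sequences. *)
Section Completion.
Variables (R : comNzRingType) (m : idealr R).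

Definition ideal_pow (k : nat) : {pred R^o} :=
  iter k (mulmod (m : {pred R^o})) predT.

Lemma ideal_pow_submod_closed k : submod_closed (ideal_pow k).
Proof. by case: k => [|k]; [split | exact: submodClosedP]. Qed.

HB.instance Definition _ k :=
  GRing.isSubmodClosed.Build R R^o (ideal_pow k) (ideal_pow_submod_closed k).

Definition cauchy : {pred nat -> R} := fun u =>
  `[< forall k, exists N, forall i j, (N <= i)%N -> (N <= j)%N ->
        u i - u j \in ideal_pow k >].

Lemma cauchyP (u : nat -> R) :
  reflect (forall k, exists N, forall i j, (N <= i)%N -> (N <= j)%N ->
             u i - u j \in ideal_pow k) (u \in cauchy).
Proof. exact: asboolP. Qed.

Lemma ideal_pow0 k : (0 : R) \in ideal_pow k.
Proof. exact: (@rpred0 R^o (ideal_pow k)). Qed.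

Lemma ideal_powD k (x y : R) :
  x \in ideal_pow k -> y \in ideal_pow k -> x + y \in ideal_pow k.
Proof. exact: (@rpredD R^o (ideal_pow k)). Qed.

Lemma ideal_powB k (x y : R) :
  x \in ideal_pow k -> y \in ideal_pow k -> x - y \in ideal_pow k.
Proof. exact: (@rpredB R^o (ideal_pow k)). Qed.

Lemma ideal_powM k (a x : R) : x \in ideal_pow k -> a * x \in ideal_pow k.
Proof. exact: (@rpredZ R R^o (ideal_pow k)). Qed.

Let subACA (a b c d : R) : (a - b) - (c - d) = (a - c) - (b - d).
Proof. by rewrite !opprB addrACA [RHS]addrACA [- b - c]addrC. Qed.

Lemma cauchy_subring_closed : subring_closed cauchy.
Proof.
split.
- apply/cauchyP => k; exists 0%N => i j _ _.
  by rewrite subrr ideal_pow0.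
- move=> u v /cauchyP uC /cauchyP vC; apply/cauchyP => k.
  have [N uN] := uC k; have [p vp] := vC k.
  exists (maxn N p) => i j; rewrite !geq_max => /andP[Ni pi] /andP[Nj pj].
  have -> : (u - v) i - (u - v) j = (u i - u j) - (v i - v j).
    exact: subACA.
  by apply: ideal_powB; [exact: uN | exact: vp].
- move=> u v /cauchyP uC /cauchyP vC; apply/cauchyP => k.
  have [N uN] := uC k; have [p vp] := vC k.
  exists (maxn N p) => i j; rewrite !geq_max => /andP[Ni pi] /andP[Nj pj].
  have -> : (u * v) i - (u * v) j = v i * (u i - u j) + u j * (v i - v j).
    rewrite [(u * v) i]/(u i * v i) [(u * v) j]/(u j * v j) !mulrBr.
    by rewrite [v i * u i]mulrC [v i * u j]mulrC addrA subrK.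
  by apply: ideal_powD; apply: ideal_powM; [exact: uN | exact: vp].
Qed.

HB.instance Definition _ :=
  GRing.isSubringClosed.Build (nat -> R) cauchy cauchy_subring_closed.

Definition cauchy_type : Type := {u : nat -> R | u \in cauchy}.
HB.instance Definition _ := SubChoice.on cauchy_type.
HB.instance Definition _ := [SubChoice_isSubComNzRing of cauchy_type by <:].

Definition null_seq : {pred cauchy_type} := fun u =>
  `[< forall k, exists N, forall i, (N <= i)%N -> val u i \in ideal_pow k >].

Lemma null_seqP (u : cauchy_type) :
  reflect (forall k, exists N, forall i, (N <= i)%N -> val u i \in ideal_pow k)
    (u \in null_seq).
Proof. exact: asboolP. Qed.

Lemma ideal_pow1 (x : R) : x \in ideal_pow 1 -> x \in m.
Proof.
move=> /lspanP[n [c [a [aA ->]]]]; apply: rpred_sum => i _.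
have /asboolP[y [z [ym _ ->]]] := aA i.
by apply: idealMr; rewrite mulrC; apply: idealMr.
Qed.

Lemma null_seq_idealr_closed : idealr_closed null_seq.
Proof.
split.
- by apply/null_seqP => k; exists 0%N => i _; exact: ideal_pow0.
- apply/negP => /null_seqP/(_ 1%N)[N /(_ N (leqnn N))] /ideal_pow1.
  by rewrite [val _ _]/(1 : R) idealr1.
- move=> a u v /null_seqP uN /null_seqP vN; apply/null_seqP => k.
  have [N {}uN] := uN k; have [p {}vN] := vN k.
  exists (maxn N p) => i; rewrite geq_max => /andP[Ni pi].
  rewrite [val _ _]/(val a i * val u i + val v i).
  by apply: ideal_powD; [apply: ideal_powM; exact: uN | exact: vN].
Qed.

HB.instance Definition _ :=
  isIdealr.Build cauchy_type null_seq null_seq_idealr_closed.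

Definition completion : Type := {ideal_quot null_seq}.
HB.instance Definition _ := GRing.ComNzRing.on completion.

Definition analytically_irreducible : Prop :=
  GRing.integral_domain_axiom completion.

End Completion.

(* The natural map from R/m to the residue field of the integral closure is an
   isomorphism.  Quantifying over all maximal ideals n avoids presupposing that
   the integral closure is local. *)
Definition residually_rational (R : idomainType) (m : idealr R) : Prop :=
  forall n : idealr (int_closure R), maximal_ideal n ->
  exists2 f : {rmorphism {ideal_quot m} -> {ideal_quot n}}, bijective f &
    forall r : R, f (\pi_{ideal_quot m} r)
                  = \pi_{ideal_quot n} (to_int_closure r).

Section Graded.
Variables (R : idomainType) (k : fieldType) (n : nat).
Variable phi : {rmorphism R -> {mpoly k[n]}}.

(* phi identifies R with a k-subalgebra S which contains the homogeneous
   components p@_w *: 'X_[w] of each of its elements p. *)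
Definition standard_graded_subalgebra : Prop :=
  injective phi /\
  exists S : subalgClosed {mpoly k[n]},
    (forall p, p \in S <-> exists r, phi r = p) /\
    (forall p w, p \in S -> p@_w *: 'X_[w] \in S).

(* The element a / b of the field of fractions of R is x^w in k(x_1, ..., x_n),
   with w in Z^n. *)
Definition x_monomial (y : {fraction R}) : Prop :=
  exists (w : 'I_n -> int) (a b : R),
    [/\ b != 0, y = tofrac a / tofrac b
      & tofrac (phi a) / tofrac (phi b)
        = \prod_(i < n) (tofrac ('X_i : {mpoly k[n]})) ^ w i].

End Graded.

Section MaximalIdealPowers.
Variables (R : idomainType) (m : idealr R) (t : int_closure R).

Definition ideal_image : {pred {fraction R}} := fun x =>
  `[< exists2 r, r \in m & x = tofrac r >].

Definition generated_by_powers : Prop :=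
  exists ns : seq nat, ideal_image =i span_seq [seq val t ^+ n | n <- ns].

Definition t_monomial (y : {fraction R}) : Prop := exists z : int, y = val t ^ z.

End MaximalIdealPowers.

Definition monomial_frac_ideal (R : idomainType) (mon : {fraction R} -> Prop)
  (J : {pred {fraction R}}) : Prop :=
  exists s : seq {fraction R}, (forall b, b \in s -> mon b) /\ J =i span_seq s.

(* Main.v *)
Require Import Defs.
From HB Require Import structures.
From mathcomp Require Import all_boot all_order all_algebra ring_quotient.
From mathcomp Require Import generic_quotient boolp classical_sets.
From mathcomp Require Import freeg mpoly zify.

Set Implicit Arguments.
Unset Strict Implicit.
Unset Printing Implicit Defensive.

Import GRing.Theory.
Local Open Scope ring_scope.
Local Open Scope quotient_scope.

(** The multiplication map [mu : I ⊗ J -> K] has kernel exactly the torsion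
    submodule (Lemma [torsion0_mul_inj]): [K] is torsion-free, and conversely, after
    multiplication by a common denominator, every tensor becomes a pure tensor
    [x0 ⊗ y], which vanishes as soon as [x0 * y = 0]. Hence (1) says that [mu] is
    injective.

    (1) implies (2). If [P + Q = I], then sending [(p + q) ⊗ y] to the class of
    [p * y] gives a well-defined map from [I ⊗ J] to [K / (P ∩ Q) J]
    (Lemma [tensor_proj_lift]). An element [z] of [PJ ∩ QJ] lifts to a tensor
    with left factors in [P] and to one with left factors in [Q]. By injectivity of
    [mu] these two tensors are equal; the first is sent to the class of [z], the second
    to 0, so [z] lies in [(P ∩ Q) J].

    (2) implies (3) by specialization.

    (3) implies (1). The two settings share one property, isolated in
    [monomial_system]: all [R]-linear relations between monomials follow
    from the relations [r * x = x'] where [r] is a monomial of [R]. In other words,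
    a function [e] with [e (r * x) = r e(x)], on a set of monomials that is closed under
    multiplication by the monomials of [R], extends linearly.
    It follows that intersections of monomial modules are monomial ([mspanI]) and,
    since the non-invertible monomials of [R] generate a proper ideal, that a monomial in
    a monomial module is a monomial multiple of one of the generators
    ([mem_mspanE]). Now let [x] be a monomial. If both [x / a_i] and [x / a_j] lie in [J],
    then [a_i ⊗ (x / a_i) = a_j ⊗ (x / a_j)] ([tns_mon_eq]): otherwise let [S] be
    the set of indices that give the same tensor as [i]; by (3) and the
    two facts above, [x = r u b] with a monomial [u] in both [(a_l | l ∈ S)] and
    [(a_l | l ∉ S)], and moving [u] across the tensor sign identifies a tensor
    indexed in [S] with one indexed outside. So [e x = a_i ⊗ (x / a_i)]
    is a well-defined function, its linear extension is inverse to [mu], and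
    [mu] is injective.

    It remains to show that the relations between monomials are the trivial ones. In case
    (a), all the monomials have a common monomial denominator, so the relation
    lives in the polynomial ring, and its coefficients can be
    compared degree by degree ([graded_mon_free]). In case (b), consider a relation
    between powers of [t], and let [n] be a maximal ideal of the integral closure that
    contains [t]. The coefficient of the lowest power lies in [n ∩ R = m], hence
    is a combination of the generators [t ^ n_l], and can be pushed to higher powers of
    [t] by trivial relations. After sufficiently many steps every power
    that occurs has a factor [t ^ q] in [m] that can be split off. Hence the module of
    values of [e] on relations equals [t ^ q] times itself. It is finitely generated
    since [R] is Noetherian, so it is zero ([divisible_eq0], [power_free]). *)

(** * Spans, quotients and tensor products *)

Section SpanTheory.
Variables (R : comNzRingType) (V : lmodType R).
Implicit Types (A B : {pred V}) (N : submodClosed V).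

Lemma submodB N x y : x \in N -> y \in N -> x - y \in N.
Proof. by move=> xN yN; rewrite -scaleN1r rpredD // rpredZ. Qed.

Lemma mem_lspan A v : v \in A -> v \in lspan A.
Proof.
move=> vA; apply/lspanP; exists 1%N, (fun=> 1), (fun=> v); split=> //.
by rewrite big_ord1 scale1r.
Qed.

Lemma lspan_ind A (P : V -> Prop) :
  P 0 -> (forall r u v, u \in A -> P v -> P (r *: u + v)) ->
  forall v, v \in lspan A -> P v.
Proof.
move=> P0 PD v /lspanP[n [c [a [aA ->]]]].
by elim/big_rec: _ => // i w _; apply: PD.
Qed.

Lemma lspan_min A N : {subset A <= N} -> {subset lspan A <= N}.
Proof.
move=> AN v; apply: (lspan_ind (P := fun v => v \in N)) => [|r u w uA wN].
  exact: rpred0.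
by rewrite rpredD // rpredZ // AN.
Qed.

Lemma lspanS A B : {subset A <= B} -> {subset lspan A <= lspan B}.
Proof. by move=> AB; apply: lspan_min => v /AB; apply: mem_lspan. Qed.

Lemma mem_span_seq (s : seq V) v : v \in s -> v \in span_seq s.
Proof. by move=> vs; apply: mem_lspan. Qed.

Lemma span_seq_ind (s : seq V) (P : V -> Prop) :
  P 0 -> (forall r u v, u \in s -> P v -> P (r *: u + v)) ->
  forall v, v \in span_seq s -> P v.
Proof. by move=> P0 PD; apply: lspan_ind => // r u v us; apply: PD. Qed.

Lemma span_seq_min (s : seq V) N :
  {subset s <= N} -> {subset span_seq s <= N}.
Proof. by move=> sN; apply: lspan_min => v vs; apply: sN. Qed.

Lemma quotmod_pi_linear N : linear (quotmod_pi N).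
Proof.
by move=> r u v; rewrite quotmod_piD -quotmod_scale_pi.
Qed.
HB.instance Definition _ N :=
  GRing.isLinear.Build R V (quotmod N) _ (quotmod_pi N) (quotmod_pi_linear N).

Lemma quotmod_pi_eq0 N v : (quotmod_pi N v == 0) = (v \in N).
Proof.
rewrite -(raddf0 (quotmod_pi N)) -[v in RHS]subr0.
by rewrite -[RHS]/(_ \in zsubmod N) Quotient.idealrBE.
Qed.

Lemma quotmod_lift N (T : lmodType R) (F : {linear V -> T}) :
  {in N, forall v, F v = 0} ->
  exists g : {linear quotmod N -> T}, forall v, g (quotmod_pi N v) = F v.
Proof.
move=> F0; pose g (z : quotmod N) := F (repr (z : {ideal_quot zsubmod N})).
have gE v : g (quotmod_pi N v) = F v.
  have /F0 : repr (quotmod_pi N v : {ideal_quot zsubmod N}) - v \in N.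
    by rewrite -quotmod_pi_eq0 raddfB subr_eq0 /= /quotmod_pi reprK.
  by rewrite raddfB => /subr0_eq.
have gL : linear g.
  move=> r x y; have [u ->] := quotmodP x; have [v ->] := quotmodP y.
  by rewrite -linearP !gE linearP.
pose h : {linear quotmod N -> T} :=
  HB.pack g (GRing.isLinear.Build R (quotmod N) T _ g gL).
by exists h.
Qed.

End SpanTheory.

Section TensorTheory.
Variables (R : comNzRingType) (M N : lmodType R).
Implicit Types (x : M) (y : N).

Local Notation "[ x , y ]" := (<< (x, y) >> : {freeg (M * N)%type / R}).

Lemma tens_rel0 u : tensor_relator u -> quotmod_pi (@tensor_rels R M N) u = 0.
Proof.
by move=> ru; apply/eqP; rewrite quotmod_pi_eq0; apply/mem_lspan/asboolP.
Qed.

Lemma tensDl x x' y : tens (x + x') y = tens x y + tens x' y.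
Proof.
apply/eqP; rewrite -subr_eq0 opprD addrA /tens -!raddfB; apply/eqP.
exact/tens_rel0/RelDl.
Qed.

Lemma tensDr x y y' : tens x (y + y') = tens x y + tens x y'.
Proof.
apply/eqP; rewrite -subr_eq0 opprD addrA /tens -!raddfB; apply/eqP.
exact/tens_rel0/RelDr.
Qed.

Lemma tensZl r x y : tens (r *: x) y = r *: tens x y.
Proof.
apply/eqP; rewrite -subr_eq0 /tens -linearZ -raddfB; apply/eqP.
exact/tens_rel0/RelZl.
Qed.

Lemma tensZr r x y : tens x (r *: y) = r *: tens x y.
Proof.
apply/eqP; rewrite -subr_eq0 /tens -linearZ -raddfB; apply/eqP.
exact/tens_rel0/RelZr.
Qed.

Lemma tens0r x : tens x (0 : N) = 0.
Proof. by rewrite -(scale0r (0 : N)) tensZr scale0r. Qed.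

Lemma tensor_sum (z : tensor M N) :
  exists n (x : 'I_n -> M) (y : 'I_n -> N), z = \sum_i tens (x i) (y i).
Proof.
have [u ->] := quotmodP z; rewrite -(freeg_sumE u).
pose d := dom u; rewrite -/d (big_nth (0, 0)) big_mkord raddf_sum.
exists (size d), (fun i => coeff (nth (0, 0) d i) u *: (nth (0, 0) d i).1),
  (fun i => (nth (0, 0) d i).2).
apply: eq_bigr => i _; rewrite tensZl /tens -linearZ /=.
by case: (nth _ _ _) => p q /=; congr quotmod_pi; apply/eqP;
  apply/freeg_eqP => w; rewrite coeffZ !coeffU mulrA mulr1.
Qed.

HB.instance Definition _ (K : choiceType) (T : lmodType R) (f : K -> T) :=
  GRing.isZmodMorphism.Build {freeg K / R} T (fglift f) (lift_is_additive f).

(** The universal property, with [tensor] presented by generators and relations: the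
    linear extension of [f] to the free module kills each of the four kinds of
    relators. *)
Lemma tensor_lift (T : lmodType R) (f : M -> N -> T) :
  (forall x x' y, f (x + x') y = f x y + f x' y) ->
  (forall x y y', f x (y + y') = f x y + f x y') ->
  (forall r x y, f (r *: x) y = r *: f x y) ->
  (forall r x y, f x (r *: y) = r *: f x y) ->
  exists g : {linear tensor M N -> T}, forall x y, g (tens x y) = f x y.
Proof.
move=> fDl fDr fZl fZr.
pose F : {additive {freeg (M * N)%type / R} -> T} :=
  fglift (fun p : M * N => f p.1 p.2 : T).
have FU x y : F [x, y] = f x y by rewrite /F /= liftU scale1r.
have FZ r u : F (r *: u) = r *: F u.
  rewrite -(freeg_sumE u) scaler_sumr !raddf_sum.
  apply: eq_bigr => i _ /=.
  have -> : r *: << coeff i u *g i >> = << (r * coeff i u) *g i >>.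
    by apply/eqP/freeg_eqP => w; rewrite coeffZ !coeffU mulrA.
  by rewrite /F /= !liftU scalerA.
have FL : linear F by move=> r u v; rewrite raddfD /= FZ.
pose G : {linear {freeg (M * N)%type / R} -> T} :=
  HB.pack (F : _ -> _) (GRing.isLinear.Build R {freeg (M * N)%type / R} T _ F FL).
have G0 : {in @tensor_rels R M N, forall u, G u = 0}.
  apply: (lspan_ind (P := fun u => G u = 0)); first exact: raddf0.
  move=> r u v /asboolP ru Gv.
  rewrite linearP /= (Gv : F v = 0) addr0 (_ : F u = 0) ?scaler0 //.
  case: ru => *; rewrite !raddfB /= ?FZ !FU ?fDl ?fDr ?fZl ?fZr.
  - by rewrite addrAC addrK subrr.
  - by rewrite addrAC addrK subrr.
  - by rewrite subrr.
  - by rewrite subrr.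
have [g gE] := quotmod_lift G0.
by exists g => x y; rewrite /tens gE; apply: FU.
Qed.

Lemma tensor_ind (P : tensor M N -> Prop) :
  P 0 -> (forall x y z, P z -> P (tens x y + z)) -> forall z, P z.
Proof.
move=> P0 PD z; have [n [x [y ->]]] := tensor_sum z.
by elim/big_rec: _ => // i w _; apply: PD.
Qed.

End TensorTheory.

(** * Multiplication map and torsion *)

Section FractionalIdeals.
Variable R : idomainType.
Local Notation K := {fraction R}.
Implicit Types (I J N P Q : submodClosed K) (r : R).

Lemma scale_fracE r (x : K) : r *: x = tofrac r * x.
Proof. by []. Qed.

Lemma scale_fracAr r (x y : K) : x * (r *: y) = r *: (x * y).
Proof. by rewrite !scale_fracE mulrCA. Qed.

Lemma frac_repr (x : K) : exists2 r, r != 0 & exists s, r *: x = tofrac s.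
Proof.
elim/quotW: x => q; exists \d_q; first exact: denom_ratioP.
exists \n_q; rewrite scale_fracE; unlock FracField.tofrac.
rewrite -[LHS](FracField.pi_mul); apply/eqmodP => /=.
rewrite FracField.equivfE /FracField.mulf.
by rewrite !numden_Ratio ?mulf_neq0 ?oner_eq0 ?denom_ratioP // !mul1r mulr1 mulrC.
Qed.

Lemma mulmod_prod (A B : {pred K}) x y : x \in A -> y \in B -> x * y \in mulmod A B.
Proof. by move=> xA yB; apply/mem_lspan/asboolP; exists x, y. Qed.

Lemma mulmod_min (A B : {pred K}) N :
  (forall x y, x \in A -> y \in B -> x * y \in N) -> {subset mulmod A B <= N}.
Proof.
by move=> AB; apply: lspan_min => _ /asboolP[x [y [xA yB ->]]]; apply: AB.
Qed.

Lemma mulmodSl (A A' B : {pred K}) :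
  {subset A <= A'} -> {subset mulmod A B <= mulmod A' B}.
Proof. by move=> AA'; apply: mulmod_min => x y /AA'; apply: mulmod_prod. Qed.

(** Coefficients can be absorbed in the left factor, which ranges over a module. *)
Lemma mulmod_ind N (B : {pred K}) (P : K -> Prop) :
  P 0 -> (forall x y z, x \in N -> y \in B -> P z -> P (x * y + z)) ->
  forall z, z \in mulmod N B -> P z.
Proof.
move=> P0 PD; apply: lspan_ind => // r _ z /asboolP[x [y [xN yB ->]]] Pz.
by rewrite scalerAl; apply: PD => //; apply: rpredZ.
Qed.

Section Tensor.
Variables I J : submodClosed K.
Local Notation IJ := (tensor (submod_type I) (submod_type J)).

Lemma tensor_mul :
  exists mu : {linear IJ -> K}, forall x y, mu (tens x y) = val x * val y.
Proof.
apply: tensor_lift => [x x' y|x y y'|r x y|r x y].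
- by rewrite -mulrDl.
- by rewrite -mulrDr.
- by rewrite scalerAl.
- by rewrite -scale_fracAr.
Qed.

(** Torsion is killed by [mu] because [K] is torsion-free. Conversely, any
    nonzero [x0] in [I] spans [I] up to denominators, so every tensor [z]
    satisfies [c *: z = x0 ⊗ y] for some [y] and some nonzero [c]; if [mu z = 0]
    then [x0 * y = 0], so [y = 0] and [z] is torsion. *)
Lemma torsion0_mul_inj (mu : {linear IJ -> K}) :
  (forall x y, mu (tens x y) = val x * val y) ->
  (exists2 x, x \in I & x != 0) ->
  torsion IJ =i pred1 0 <-> forall z, mu z = 0 -> z = 0.
Proof.
move=> muE [x0 x0I x0n0]; split=> [tors0 z muz|inj z]; last first.
  rewrite inE; apply/asboolP/eqP => [[r rn0 rz]|->]; last first.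
    by exists 1; rewrite ?oner_eq0 ?scaler0.
  apply: inj; have /eqP : tofrac r * mu z = 0.
    by rewrite -scale_fracE -linearZ_LR rz raddf0.
  by rewrite mulf_eq0 tofrac_eq0 (negPf rn0) => /eqP.
apply/eqP; rewrite -[_ == _]/(z \in pred1 0) -tors0; apply/asboolP.
pose u0 : submod_type I := exist _ x0 x0I.
have [c cn0 [y yE]] : exists2 c, c != 0 & exists y, c *: z = tens u0 y.
  elim/tensor_ind: z {muz} => [|x y z [c cn0 [y' cz]]].
    exists 1; first exact: oner_neq0.
    by exists 0; rewrite scaler0 tens0r.
  have [r rn0 [s rs]] := frac_repr (val x / x0).
  have rx : r *: x = s *: u0.
    apply: val_inj; apply: (mulIf (invr_neq0 x0n0)).
    by rewrite -[LHS]scalerAl -[RHS]scalerAl mulfV // rs [RHS]scale_fracE mulr1.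
  exists (c * r); first by rewrite mulf_neq0.
  exists (c *: (s *: y) + r *: y').
  rewrite scalerDr -scalerA -tensZl rx mulrC -scalerA cz.
  by rewrite tensDr !tensZr tensZl.
exists c => //; rewrite yE (_ : y = 0) ?tens0r //.
apply: val_inj; apply/(mulfI x0n0).
by rewrite -[x0]/(val u0) -muE -yE linearZ_LR muz scaler0 mulr0.
Qed.

(** The component [p] of [x = p + q] is determined up to [P ∩ Q], so [p * y] is
    well defined modulo [(P ∩ Q) J] and bilinear in [x] and [y]. *)
Lemma tensor_proj_lift P Q : addmod P Q =i I ->
  exists g : {linear IJ -> quotmod (mulmod [predI P & Q] J)},
    (forall (x : submod_type I) y, val x \in P ->
       g (tens x y) = quotmod_pi _ (val x * val y))
    /\ (forall (x : submod_type I) y, val x \in Q -> g (tens x y) = 0).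
Proof.
move=> PQI.
have /choice[p pP] : forall x : submod_type I, exists p, p \in P /\ val x - p \in Q.
  move=> x; have := valP x; rewrite -PQI => /asboolP[p [q [pP qQ ->]]].
  by exists p; rewrite addrC addKr.
set N := mulmod _ _.
(* [p] is an arbitrary choice of components; [pE] says that it does not matter *)
have pE (x : submod_type I) p' (y : submod_type J) : p' \in P -> val x - p' \in Q ->
    quotmod_pi N (p x * val y) = quotmod_pi N (p' * val y).
  move=> p'P xp'; apply/eqP; have [pxP xpQ] := pP x.
  rewrite -subr_eq0 -raddfB quotmod_pi_eq0 -mulrBl; apply: mulmod_prod.
    rewrite inE; apply/andP; split; first exact: submodB.
    by have := submodB xp' xpQ; rewrite opprB addrC addrA subrK.
  exact: valP.
have [g gE] : exists g : {linear IJ -> quotmod N},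
    forall x y, g (tens x y) = quotmod_pi N (p x * val y).
  apply: (tensor_lift (f := fun x y => quotmod_pi N (p x * val y))).
  - move=> x x' y; rewrite (pE _ (p x + p x')) ?mulrDl ?quotmod_piD //.
      by rewrite rpredD // (pP _).1.
    by rewrite opprD addrACA rpredD // (pP _).2.
  - by move=> x y y'; rewrite -quotmod_piD -mulrDr.
  - move=> r x y; rewrite -linearZ_LR scalerAl; apply: pE.
      by rewrite rpredZ // (pP _).1.
    suff: r *: (val x - p x) \in Q by rewrite scalerBr.
    by rewrite rpredZ // (pP _).2.
  - by move=> r x y; rewrite -linearZ_LR -scale_fracAr.
exists g; split=> x y xPQ; rewrite gE.
  by apply: pE; rewrite ?subrr ?rpred0.
by rewrite (pE _ 0) ?rpred0 ?subr0 // mul0r raddf0.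
Qed.

(** An element [z] of both [PJ] and [QJ] lifts to tensors [u], with left factors
    in [P], and [v], with left factors in [Q]. Injectivity forces [u = v], while
    the map of [tensor_proj_lift] sends [u] to the class of [z] and [v] to 0. *)
Lemma mul_inj_capM (mu : {linear IJ -> K}) P Q :
  (forall x y, mu (tens x y) = val x * val y) ->
  (forall z, mu z = 0 -> z = 0) -> addmod P Q =i I ->
  mulmod [predI P & Q] J =i [predI mulmod P J & mulmod Q J].
Proof.
move=> muE inj PQI z; apply/idP/idP.
  by move=> zPQ; rewrite inE /=; apply/andP; split;
    apply: mulmodSl zPQ => x /andP[].
case/andP=> zP zQ.
have [g [gP gQ]] := tensor_proj_lift PQI.
have PI : {subset P <= I}.
  move=> x xP; rewrite -PQI; apply/asboolP; exists x, 0.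
  by rewrite rpred0 addr0.
have QI : {subset Q <= I}.
  move=> x xQ; rewrite -PQI; apply/asboolP; exists 0, x.
  by rewrite rpred0 add0r.
have [u muu gu] : exists2 u, mu u = z & g u = quotmod_pi _ z.
  elim/(mulmod_ind (N := P)): z / zP {zQ} => [|x y z xP yJ [u muu gu]].
    by exists 0; rewrite !raddf0.
  pose x' : submod_type I := exist _ x (PI _ xP).
  pose y' : submod_type J := exist _ y yJ.
  exists (tens x' y' + u); first by rewrite raddfD /= muE muu.
  by rewrite !raddfD /= gP // gu.
have [v muv gv] : exists2 v, mu v = z & g v = 0.
  elim/(mulmod_ind (N := Q)): z / zQ {zP u muu gu} => [|x y z xQ yJ [u muu gu]].
    by exists 0; rewrite !raddf0.
  pose x' : submod_type I := exist _ x (QI _ xQ).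
  pose y' : submod_type J := exist _ y yJ.
  exists (tens x' y' + u); first by rewrite raddfD /= muE muu.
  by rewrite raddfD /= gQ // gu addr0.
apply/idP; rewrite -quotmod_pi_eq0 -gu (_ : u = v) ?gv //.
by apply/eqP; rewrite -subr_eq0; apply/eqP/inj; rewrite raddfB /= muu muv subrr.
Qed.

End Tensor.
End FractionalIdeals.

(** * Monomial systems *)

Section MonomialSystems.
Variable R : idomainType.
Local Notation K := {fraction R}.
Implicit Types (I J N P Q : submodClosed K) (r : R) (G X Y D : K -> Prop).

Definition mspan X : {pred K} := lspan (fun x => `[< X x >]).
HB.instance Definition _ X := GRing.SubmodClosed.on (mspan X).

(** The graph of the would-be linear extension of [e] to the span of [D]: a
    relation between elements of [D] on which [e] takes the value [z] is the
    same as an element [(z, 0)] of this module. *)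
Definition graph_span (T : lmodType R) D (e : K -> T) : {pred T * K} :=
  lspan (fun p => `[< exists2 m, D m & p = (e m, m) >]).
HB.instance Definition _ T D e := GRing.SubmodClosed.on (@graph_span T D e).

Definition monomially_closed G D :=
  forall r m, D m -> G (tofrac r) -> D (r *: m).

(** What the two settings have in common. The field [mon_free] says that the
    linear relations between monomials are generated by the relations [r *: m =
    m'] with [r] a monomial of [R]; it is phrased as an extension property so
    that it can be used with values in tensor products and in quotients. *)
Record monomial_system G : Prop := MonomialSystem {
  mon_neq0 : forall m, G m -> m != 0;
  monM : forall m m', G m -> G m' -> G (m * m');
  monV : forall m, G m -> G m^-1;
  mon_nonunit :
    1 \notin mspan (fun u => G u /\ exists2 r, u = tofrac r & r \isn't a GRing.unit);
  mon_free : forall (T : lmodType R) D (e : K -> T),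
    (forall m, D m -> G m) -> monomially_closed G D ->
    (forall r m, D m -> G (tofrac r) -> e (r *: m) = r *: e m) ->
    forall z, (z, 0) \in graph_span D e -> z = 0 }.

Lemma mem_mspan X m : X m -> m \in mspan X.
Proof. by move=> Xm; apply/mem_lspan/asboolP. Qed.

Lemma mspan_min X N : (forall m, X m -> m \in N) -> {subset mspan X <= N}.
Proof. by move=> XN; apply: lspan_min => m /asboolP/XN. Qed.

Lemma mspan_ind X (P : K -> Prop) :
  P 0 -> (forall r u v, X u -> P v -> P (r *: u + v)) ->
  forall v, v \in mspan X -> P v.
Proof. by move=> P0 PD; apply: lspan_ind => // r u v /asboolP; apply: PD. Qed.

Lemma mem_graph_span (T : lmodType R) D (e : K -> T) m :
  D m -> (e m, m) \in graph_span D e.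
Proof. by move=> Dm; apply/mem_lspan/asboolP; exists m. Qed.

Variable G : K -> Prop.
Hypothesis monG : monomial_system G.

(** Apply [mon_free] to the function [e] which is the projection modulo the span
    of [X ∩ Y] on [X] and zero on [Y]; it is compatible with monomial
    multiplication. An element of both spans receives two values, its class and
    0, which must agree. *)
Lemma mspanI X Y : (forall m, X m -> G m) -> (forall m, Y m -> G m) ->
  monomially_closed G X -> monomially_closed G Y ->
  {subset [predI mspan X & mspan Y] <= mspan (fun m => X m /\ Y m)}.
Proof.
move=> XG YG Xcl Ycl v /andP[/= vX vY].
set N := mspan _.
pose e m := if `[< X m >] then quotmod_pi N m else 0.
pose D m := X m \/ Y m.
have eX m : X m -> e m = quotmod_pi N m by move=> Xm; rewrite /e asboolT.
have eY m : Y m -> e m = 0.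
  rewrite /e; case: asboolP => // Xm Ym.
  by apply/eqP; rewrite quotmod_pi_eq0; apply: mem_mspan.
have vXe : forall v, v \in mspan X -> (quotmod_pi N v, v) \in graph_span D e.
  apply: mspan_ind => [|r u w].
    by rewrite raddf0 rpred0.
  move=> Xu wD; rewrite linearP /=.
  rewrite (_ : (_, _) = r *: (e u, u) + (quotmod_pi N w, w)); last by rewrite eX.
  by rewrite rpredD // rpredZ // mem_graph_span //; left.
have vYe : forall v, v \in mspan Y -> (0, v) \in graph_span D e.
  apply: mspan_ind => [|r u w].
    by rewrite rpred0.
  move=> Yu wD.
  rewrite (_ : (_, _) = r *: (e u, u) + (0, w)).
    by rewrite rpredD // rpredZ // mem_graph_span //; right.
  by rewrite eY //; congr (_, _); rewrite /= scaler0 addr0.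
apply/idP; rewrite -quotmod_pi_eq0; apply/eqP.
apply: (mon_free monG (D := D) (e := e)).
- by move=> m [/XG|/YG].
- by move=> r m [/Xcl|/Ycl] cl Gr; [left | right]; apply: cl.
- move=> r m [Xm|Ym] Gr.
    by rewrite !eX ?linearZ_LR //; apply: Xcl.
  by rewrite !eY ?scaler0 //; apply: Ycl.
- rewrite (_ : (_, _) = (quotmod_pi N v, v) - (0, v)).
    by rewrite submodB ?vXe ?vYe.
  by congr (_, _); rewrite /= ?subr0 ?subrr.
Qed.

(** Intersect the span of [Y] with [R m]. If [m] is not in [Y], every monomial
    of the intersection is [s *: m] with [s] non-invertible, because [Y] is
    closed under multiplication by the inverse of an invertible [s]; dividing by
    [m] puts 1 in the ideal generated by the non-invertible monomials. *)
Lemma mem_mspanE Y m : (forall m, Y m -> G m) -> monomially_closed G Y ->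
  G m -> m \in mspan Y -> Y m.
Proof.
move=> YG Ycl Gm mY; apply: contrapT => nYm.
have mn0 := mon_neq0 monG Gm.
pose X m' := G m' /\ exists r, m' = r *: m.
have XG m' : X m' -> G m' by case.
have Xcl : monomially_closed G X.
  move=> r m' [Gm' [s ms]] Gr; split; last by exists (r * s); rewrite ms scalerA.
  by rewrite scale_fracE; apply: (monM monG).
have Xm : X m by split=> //; exists 1; rewrite scale1r.
have : m \in mspan (fun m => X m /\ Y m).
  by apply: mspanI => //; rewrite inE /= mem_mspan.
set N := mspan (fun u => _ /\ _) => mN.
apply: (negP (mon_nonunit monG)).
set U := mspan _.
rewrite -(divff mn0).
suff: forall v, v \in N -> v / m \in U by apply.
apply: mspan_ind => [|r u v].
  by rewrite mul0r rpred0.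
move=> [[Gu [s us]] Yu] vU.
rewrite mulrDl -scalerAl rpredD // rpredZ // mem_mspan //; split.
  by apply: (monM monG) => //; apply: (monV monG).
exists s; first by rewrite us scale_fracE mulfK.
apply/negP => su; apply: nYm.
have Gs : G (tofrac s^-1).
  have -> : tofrac s^-1 = m / u.
    rewrite us scale_fracE invfM mulrA mulrAC divff // mul1r.
    apply: (mulfI (mon_neq0 monG (_ : G (tofrac s)))).
      rewrite -[tofrac s](mulfK mn0) -scale_fracE -us.
      by apply: (monM monG) => //; apply: (monV monG).
    rewrite -tofracM divrr // tofrac1 divff // tofrac_eq0.
    by apply: contraTneq su => ->; rewrite unitr0.
  by apply: (monM monG) => //; apply: (monV monG).
have := Ycl _ _ Yu Gs.
by rewrite us scalerA mulVr // scale1r.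
Qed.

End MonomialSystems.

(** * Tensor products of monomial ideals *)

Section MonomialIdeals.
Variable R : idomainType.
Local Notation K := {fraction R}.
Variable G : K -> Prop.
Hypothesis monG : monomial_system G.
Variables (I J : submodClosed K) (h : nat) (a : 'I_h -> K) (s : seq K).
Hypothesis aG : forall i, G (a i).
Hypothesis sG : forall b, b \in s -> G b.
Hypothesis I_gen : I =i span_seq [seq a i | i : 'I_h].
Hypothesis J_gen : J =i span_seq s.
Implicit Types (r : R) (C : {set 'I_h}).

Local Notation IJ := (tensor (submod_type I) (submod_type J)).
Local Notation span_in C := (span_seq [seq a i | i in C]).

Let aI i : a i \in I.
Proof. by rewrite I_gen; apply: mem_span_seq; apply/fintype.imageP; exists i. Qed.

Let sJ b : b \in s -> b \in J.
Proof. by move=> bs; rewrite J_gen; apply/mem_span_seq. Qed.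

Let an0 i : a i != 0.
Proof. exact: mon_neq0 (aG i). Qed.

(** [tens] on elements of [K], with the default value 0 in place of an argument that is outside
    [I] or [J]; the elements then need not carry membership proofs. *)
Definition tns (x y : K) : IJ :=
  tens (insubd (0 : submod_type I) x) (insubd (0 : submod_type J) y).

Lemma tns_linearl r x x' y : x \in I -> x' \in I ->
  tns (r *: x + x') y = r *: tns x y + tns x' y.
Proof.
move=> xI x'I; rewrite /tns -tensZl -tensDl; congr tens; apply: val_inj.
by rewrite /= !insubdK // -topredE /= rpredD // rpredZ.
Qed.

Lemma tns_linearr r x y y' : y \in J -> y' \in J ->
  tns x (r *: y + y') = r *: tns x y + tns x y'.
Proof.
move=> yJ y'J; rewrite /tns -tensZr -tensDr; congr tens; apply: val_inj.
by rewrite /= !insubdK // -topredE /= rpredD // rpredZ.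
Qed.

Lemma tnsZl r x y : x \in I -> tns (r *: x) y = r *: tns x y.
Proof.
move=> xI; rewrite /tns -tensZl; congr tens; apply: val_inj.
by rewrite /= !insubdK // -topredE /= rpredZ.
Qed.

Lemma tnsZr r x y : y \in J -> tns x (r *: y) = r *: tns x y.
Proof.
move=> yJ; rewrite /tns -tensZr; congr tens; apply: val_inj.
by rewrite /= !insubdK // -topredE /= rpredZ.
Qed.

Lemma tns0l y : tns 0 y = 0.
Proof. by rewrite -(scale0r 0) tnsZl ?rpred0 // scale0r. Qed.

Lemma tns0r x : tns x 0 = 0.
Proof. by rewrite -(scale0r 0) tnsZr ?rpred0 // scale0r. Qed.

Lemma tens_tns x y : tens x y = tns (val x) (val y).
Proof. by rewrite /tns !valKd. Qed.

Definition mults C (u : K) := G u /\ exists i r, i \in C /\ u = r *: a i.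

Lemma mults_closed C : monomially_closed G (mults C).
Proof.
move=> r u [Gu [i [t [iC ut]]]] Gr; split; first exact: (monM monG Gr Gu).
by exists i, (r * t); split=> //; rewrite ut scalerA.
Qed.

Lemma span_in_mults C : {subset span_in C <= mspan (mults C)}.
Proof.
apply: span_seq_min => _ /fintype.imageP[i iC ->]; apply: mem_mspan; split=> //.
by exists i, 1; rewrite scale1r.
Qed.

Lemma mem_span_in C i r : i \in C -> r *: a i \in span_in C.
Proof. by move=> iC; apply/rpredZ/mem_span_seq; apply/fintype.imageP; exists i. Qed.

(** By [mspanI] the module [(a_i | i ∈ C) ∩ (a_j | j ∉ C)] is spanned by
    monomials, and then so is its product with [J]; a monomial [m] in that
    product is a multiple of one generator by [mem_mspanE]. *)
Lemma mon_capM C m : G m ->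
  m \in mulmod [predI span_in C & span_in (~: C)] J ->
  exists u b r, [/\ mults C u, mults (~: C) u, b \in s & m = r *: (u * b)].
Proof.
move=> Gm mCJ.
pose Y m := G m /\
  exists u b r, [/\ mults C u, mults (~: C) u, b \in s & m = r *: (u * b)].
have [] // : Y m.
apply: (mem_mspanE monG) => // [m' []//|r m' [Gm' [u [b [t [uC uC' bs m'E]]]]] Gr|].
  split; first exact: (monM monG).
  by exists u, b, (r * t); split=> //; rewrite m'E scalerA.
move: m mCJ {Gm}; apply: mulmod_min => x y xC.
rewrite J_gen; move: y.
have {xC}: x \in mspan (fun u => mults C u /\ mults (~: C) u).
  apply: (mspanI monG) => [? []|? []|||] //; try exact: mults_closed.
  by case/andP: xC => xC xC'; rewrite inE /= !span_in_mults.
move: x; apply: mspan_ind => [y _|r u x [uC uC'] IHx y ys]; first by rewrite mul0r rpred0.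
rewrite mulrDl -scalerAl rpredD ?IHx // rpredZ //.
move: y ys {IHx}; apply: span_seq_ind => [|t b y bs yY]; first by rewrite mulr0 rpred0.
rewrite mulrDr scale_fracAr rpredD // rpredZ // mem_mspan //; split.
  by apply: (monM monG); [case: uC | apply: sG].
by exists u, b, 1; rewrite scale1r.
Qed.

(** Let [C] be the set of the indices that give the same tensor as [i]. If [j]
    were outside, then [m] would lie in both products, hence in [((a_i | i ∈ C)
    ∩ (a_j | j ∉ C)) J]. The monomial [u] given by [mon_capM] is a multiple of
    some [a i1] with [i1] in [C] and of some [a j1] with [j1] outside [C]; both
    tensors are equal to [r *: (u ⊗ b)], so that [j1] is in [C] as well. *)
Lemma tns_mon_eq m i j :
  (forall C, mulmod [predI span_in C & span_in (~: C)] J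
     =i [predI mulmod (span_in C) J & mulmod (span_in (~: C)) J]) ->
  G m -> m / a i \in J -> m / a j \in J ->
  tns (a i) (m / a i) = tns (a j) (m / a j).
Proof.
move=> capM Gm miJ mjJ.
pose C := [set i' | (m / a i' \in J) && (tns (a i') (m / a i') == tns (a i) (m / a i))].
have iC : i \in C by rewrite inE miJ eqxx.
suff: j \in C by rewrite inE mjJ => /eqP.
apply: contraPT iC => jC iC.
have /(mon_capM Gm) : m \in mulmod [predI span_in C & span_in (~: C)] J.
  rewrite capM inE /=; apply/andP; split.
    rewrite -(divfK (an0 i) m) mulrC; apply: mulmod_prod => //.
    by rewrite -[a i]scale1r mem_span_in.
  rewrite -(divfK (an0 j) m) mulrC; apply: mulmod_prod => //.
  by rewrite -[a j]scale1r mem_span_in // inE jC.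
case=> u [b [r [[_ [i1 [r1 [i1C ui]]]] [_ [j1 [r2 [j1C uj]]]] bs mE]]].
have quotE k t : u = t *: a k -> m / a k = (r * t) *: b.
  by move=> uk; rewrite mE uk -!scalerAl scalerA mulrAC divff // mul1r.
have tnsE k t : u = t *: a k -> tns (a k) (m / a k) = r *: tns u b.
  by move=> uk; rewrite (quotE _ _ uk) tnsZr ?sJ // uk tnsZl // scalerA.
move: j1C; rewrite !inE => /negP[]; rewrite (quotE _ _ uj) rpredZ ?sJ //=.
rewrite -(quotE _ _ uj) (tnsE _ _ uj) -(tnsE _ _ ui).
by move: i1C; rewrite inE => /andP[].
Qed.

(** The function [e], which sends [m] to [a i ⊗ (m / a i)], is well defined by
    [tns_mon_eq]. Since [(z, mu z)] belongs to its graph for every tensor [z],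
    [mon_free] gives the injectivity of [mu]. *)
Lemma capM_mul_inj (mu : {linear IJ -> K}) :
  (forall x y, mu (tens x y) = val x * val y) ->
  (forall C, mulmod [predI span_in C & span_in (~: C)] J
     =i [predI mulmod (span_in C) J & mulmod (span_in (~: C)) J]) ->
  forall z, mu z = 0 -> z = 0.
Proof.
move=> muE capM.
pose D m := G m /\ exists i, m / a i \in J.
pose e m := if [pick i | m / a i \in J] is Some i then tns (a i) (m / a i) else 0.
have eE m i : G m -> m / a i \in J -> e m = tns (a i) (m / a i).
  rewrite /e => Gm miJ; case: pickP => [j mjJ|/(_ i)]; last by rewrite miJ.
  exact: tns_mon_eq.
have Dcl : monomially_closed G D.
  move=> r m [Gm [i mi]] Gr; split; first exact: (monM monG).
  by exists i; rewrite -scalerAl rpredZ.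
have eZ r m : D m -> G (tofrac r) -> e (r *: m) = r *: e m.
  move=> Dm Gr; have [Grm _] := Dcl _ _ Dm Gr; case: Dm => [Gm [i mi]].
  by rewrite (eE _ i) // -scalerAl ?rpredZ // tnsZr // -eE.
have graph z : (z, mu z) \in graph_span D e.
  elim/tensor_ind: z => [|x y z zD]; first by rewrite raddf0 rpred0.
  rewrite raddfD /= muE tens_tns.
  rewrite (_ : (_, _) = (tns (val x) (val y), val x * val y) + (z, mu z)) //.
  rewrite rpredD //.
  suff xyD : forall x, x \in span_seq [seq a i | i : 'I_h] ->
      x \in I /\ forall y, y \in J -> (tns x y, x * y) \in graph_span D e.
    have [|_ xJ] := xyD (val x); first by rewrite -I_gen; apply: valP.
    exact/xJ/valP.
  move=> {x y z zD}; apply: span_seq_ind => [|r _ x /fintype.imageP[i _ ->] [xI xJ]].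
    by split=> [|y _]; rewrite ?rpred0 // mul0r tns0l rpred0.
  split=> [|y yJ]; first by rewrite rpredD // rpredZ.
  rewrite tns_linearl // mulrDl -scalerAl.
  rewrite (_ : (_, _) = r *: (tns (a i) y, a i * y) + (tns x y, x * y)) //.
  rewrite rpredD ?xJ // rpredZ // {xJ}.
  suff aiyD : forall y, y \in span_seq s ->
      y \in J /\ (tns (a i) y, a i * y) \in graph_span D e.
    by have [|//] := aiyD y; rewrite -J_gen.
  move=> {y yJ}.
  apply: span_seq_ind => [|t b y bs [yJ yD]].
    by split; rewrite ?rpred0 // mulr0 tns0r rpred0.
  split; first by rewrite rpredD // rpredZ ?sJ.
  rewrite (tns_linearr _ _ (sJ bs) yJ) mulrDr scale_fracAr.
  rewrite (_ : (_, _) = t *: (tns (a i) b, a i * b) + (tns (a i) y, a i * y)) //.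
  rewrite rpredD // rpredZ //.
  have Gab : G (a i * b) by apply: (monM monG) => //; apply: sG.
  have abJ : (a i * b) / a i \in J by rewrite mulrAC divff // mul1r sJ.
  rewrite -[in tns _ b](mul1r b) -(divff (an0 i)) mulrAC -eE //.
  by apply: mem_graph_span; split=> //; exists i.
move=> z muz; apply: (mon_free monG (D := D) (e := e)) => //; first by move=> m [].
by have := graph z; rewrite muz.
Qed.

End MonomialIdeals.

(** * Graded subalgebras of polynomial rings *)

Section GradedSubalgebra.
Variables (R : idomainType) (k : fieldType) (n : nat).
Variable phi : {rmorphism R -> {mpoly k[n]}}.
Local Notation K := {fraction R}.
Hypothesis phi_graded : standard_graded_subalgebra phi.
Implicit Types (r : R) (u v w : 'X_{1..n}).

Let phi_inj : injective phi := phi_graded.1.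

Definition is_mon r := exists v, phi r = 'X_[v].

(** Quotients of monomials of [R], instead of powers with exponents in [Z^n]:
    closure under products and inverses is then immediate, and denominators are
    explicit. *)
Definition frac_mon (y : K) :=
  exists a b, [/\ is_mon a, is_mon b & y = tofrac a / tofrac b].

Lemma X_neq0 v : 'X_[v] != 0 :> {mpoly k[n]}.
Proof. by rewrite -msupp_eq0 msuppX. Qed.

Lemma is_mon1 : is_mon 1.
Proof. by exists 0%MM; rewrite rmorph1 mpolyX0. Qed.

Lemma is_monM a b : is_mon a -> is_mon b -> is_mon (a * b).
Proof. by move=> [v av] [w bw]; exists (v + w)%MM; rewrite rmorphM av bw mpolyXD. Qed.

Lemma is_mon_prod (I : finType) (P : pred I) (F : I -> R) :
  (forall i, is_mon (F i)) -> is_mon (\prod_(i | P i) F i).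
Proof.
move=> Fm; elim/big_ind: _ => // [|a b]; [exact: is_mon1 | exact: is_monM].
Qed.

Lemma is_mon_neq0 a : is_mon a -> a != 0.
Proof.
move=> [v av]; apply: contraTneq (X_neq0 v) => a0.
by rewrite -av a0 rmorph0 eqxx.
Qed.

Lemma tofrac_mon a : is_mon a -> frac_mon (tofrac a).
Proof. by move=> am; exists a, 1; split=> //; [exact: is_mon1 | rewrite tofrac1 divr1]. Qed.

(** The homogeneous components of an element of [R] belong to [R], and [R]
    contains the scalars, so each monomial that occurs in it comes from [R]. *)
Lemma graded_mon r w : w \in msupp (phi r) -> exists a, phi a = 'X_[w].
Proof.
have [_ [S [SP Shom]]] := phi_graded => wr; apply/SP.
have pw : (phi r)@_w != 0 by rewrite -mcoeff_msupp.
rewrite -['X_[w]]scale1r -(mulVf pw) -scalerA rpredZ // Shom //.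
by apply/SP; exists r.
Qed.

Lemma graded_scalar (c : k) : exists a, phi a = c%:MP.
Proof.
have [_ [S [SP _]]] := phi_graded; apply/SP.
by rewrite -[c%:MP]mulr1 mul_mpolyC rpredZ // rpred1.
Qed.

Lemma frac_mon_den m (x : 'I_m -> K) : (forall i, frac_mon (x i)) ->
  exists b (r : 'I_m -> R), is_mon b /\
    forall i, is_mon (r i) /\ x i = tofrac (r i) / tofrac b.
Proof.
move=> /choice[a] /choice[b] ab.
exists (\prod_i b i), (fun i => a i * \prod_(j | j != i) b j).
split=> [|i]; first by apply: is_mon_prod => i; case: (ab i).
have [am bm ->] := ab i.
have bm' : is_mon (\prod_(j | j != i) b j).
  by apply: is_mon_prod => j; case: (ab j).
split; first exact: is_monM.
rewrite [\prod_(j < m) b j](bigD1 i) //= !tofracM invfM mulrACA mulfV ?mulr1 //.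
by rewrite tofrac_eq0 is_mon_neq0.
Qed.

(** A monomial of [R] other than 1 has no constant term, so neither has any
    element of the ideal generated by the non-invertible monomials. *)
Lemma frac_mon_nonunit :
  1 \notin mspan (fun u : K => frac_mon u /\ exists2 r, u = tofrac r & r \isn't a GRing.unit).
Proof.
set U := (X in mspan X).
apply/negP => U1.
have [r] : exists2 r, 1 = tofrac r & (phi r)@_0 = 0.
  move: U1; elim/(mspan_ind (X := U)): 1 / => [|c _ _ [[a [b [[v av] [w bw] ->]]] [s sE su]] [r -> r0]].
    by exists 0; rewrite ?tofrac0 // rmorph0 mcoeff0.
  exists (c * s + r); first by rewrite tofracD tofracM -sE.
  have abs : phi a = phi s * phi b.
    rewrite -rmorphM; congr (phi _); apply/eqP.
    rewrite -tofrac_eq tofracM -sE divfK // tofrac_eq0.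
    by rewrite is_mon_neq0 //; exists w.
  rewrite rmorphD rmorphM mcoeffD r0 addr0.
  have -> : (phi c * phi s)@_0 = (phi c)@_0 * (phi s)@_0.
    exact: (mcoeff0_is_multiplicative _ _).1.
  apply/eqP; rewrite mulf_eq0 orbC; apply/orP; left; apply: contraNT su => s0.
  have vw : v = w.
    apply/eqP; move: s0; rewrite -(mcoeffMX _ w) addm0 -bw -abs av mcoeffX.
    by case: (v == w); rewrite ?eqxx.
  suff -> : s = 1 by rewrite unitr1.
  have b0 : phi b != 0 by rewrite bw X_neq0.
  apply/phi_inj/(mulIf b0).
  by rewrite -abs rmorph1 mul1r av bw vw.
move=> r1 /eqP; have -> : r = 1 by apply/eqP; rewrite -tofrac_eq tofrac1 -r1.
by rewrite rmorph1 mcoeff1 eqxx oner_eq0.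
Qed.

(** Write [w = p - q] with [p] and [q] natural exponents. From [a X^q = b X^p]
    and a monomial [X^v] of [b] one gets a monomial [X^u] of [a] with [q + u = p
    + v]; both belong to [R], and their quotient is [a / b]. *)
Lemma x_monomial_frac_mon y : x_monomial phi y -> frac_mon y.
Proof.
move=> [w [a [b [bn0 -> ab]]]].
pose p := [multinom (if w i is Posz z then z else 0)%N | i < n].
pose q := [multinom (if w i is Negz z then z.+1 else 0)%N | i < n].
have X0 u : tofrac ('X_[u] : {mpoly k[n]}) != 0 by rewrite tofrac_eq0 X_neq0.
have phin0 r : r != 0 -> phi r != 0.
  by rewrite -(inj_eq phi_inj) rmorph0.
have abpq : phi a * 'X_[q] = phi b * 'X_[p].
  apply/eqP; rewrite [phi b * _]mulrC -tofrac_eq !tofracM -eqr_div ?X0 //; last first.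
    by rewrite tofrac_eq0 phin0.
  rewrite ab !mpolyXE_id !rmorph_prod -prodf_div; apply/eqP/eq_bigr => i _.
  rewrite !mnmE; case: (w i) => z /=.
    by rewrite expr0 tofrac1 divr1 rmorphXn.
  by rewrite expr0 tofrac1 div1r rmorphXn.
have [v vb] : exists v, v \in msupp (phi b).
  by exists (mlead (phi b)); rewrite mlead_supp ?phin0.
have cn0 : (phi b)@_v != 0 by rewrite -mcoeff_msupp.
have qpv : (phi a * 'X_[q])@_(p + v)%MM != 0 by rewrite abpq mcoeffMX.
have [u ua uE] : exists2 u, u \in msupp (phi a) & (q + u = p + v)%MM.
  move: qpv; rewrite -mcoeff_msupp (perm_mem (msuppMX _ _)).
  by case/mapP => u ua ->; exists u.
have [al alE] := graded_mon ua; have [be beE] := graded_mon vb.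
exists al, be; split; [by exists u | by exists v |].
apply/eqP; rewrite eqr_div ?tofrac_eq0 //; last first.
  by apply: is_mon_neq0; exists v.
rewrite -!tofracM tofrac_eq -(inj_eq phi_inj) !rmorphM /= alE beE.
apply/eqP/(mulIf (X_neq0 q)).
rewrite mulrAC abpq -mulrA -mpolyXD -uE mpolyXD.
by rewrite ['X_[u] * phi b]mulrC -mulrA ['X_[u] * _]mulrC.
Qed.

(** After multiplication by a common denominator, a relation becomes [\sum_i c_i
    X^(v_i) = 0] in the polynomial ring. Expanding the [c_i] into terms moves
    every [c_i *: e (m_i)] into a combination of the values [g u = e (X^u / b)],
    with coefficients that are those of the polynomial [c_i X^(v_i)]; these add
    up to 0. *)
Lemma graded_mon_free (T : lmodType R) (D : K -> Prop) (e : K -> T) :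
  (forall m, D m -> frac_mon m) -> monomially_closed frac_mon D ->
  (forall r m, D m -> frac_mon (tofrac r) -> e (r *: m) = r *: e m) ->
  forall z, (z, 0) \in graph_span D e -> z = 0.
Proof.
move=> Dmon Dcl eZ z /lspanP[N [c [x [xD zE]]]].
have /choice[m mP] : forall i, exists m, D m /\ x i = (e m, m).
  by move=> i; have /asboolP[m] := xD i; exists m.
have [b [r [bmon rP]]] := frac_mon_den (fun i => Dmon _ (mP i).1).
have [/choice[v rv] mE] : (forall i, exists v, phi (r i) = 'X_[v]) /\
    forall i, m i = tofrac (r i) / tofrac b.
  by split=> i; case: (rP i).
have zsum : z = \sum_i c i *: e (m i).
  have /= -> := congr1 fst zE; rewrite raddf_sum /=.
  by apply: eq_bigr => i _; rewrite (mP i).2.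
have rsum : \sum_i c i * r i = 0.
  apply/eqP; rewrite -tofrac_eq0 raddf_sum /=.
  have := congr1 snd zE; rewrite raddf_sum /= => msum.
  have b0 : tofrac b != 0 by rewrite tofrac_eq0 is_mon_neq0.
  apply/eqP/(mulIf (invr_neq0 b0)); rewrite mul0r [RHS]msum mulr_suml.
  by apply: eq_bigr => i _; rewrite (mP i).2 /= mE scale_fracE tofracM mulrA.
(* [kap] embeds the scalars in [R], and [rho] gives the monomials of [R] *)
have /choice[kap kapE] := graded_scalar.
have /choice[rho rhoE] : forall w, exists a, (exists s, w \in msupp (phi s)) -> phi a = 'X_[w].
  move=> w; have [[s ws]|nw] := pselect (exists s, w \in msupp (phi s)).
    by have [a aw] := graded_mon ws; exists a.
  by exists 0.
have kapD : {morph kap : x y / x + y}.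
  by move=> s t; apply: phi_inj; rewrite rmorphD !kapE raddfD.
have kap0 : kap 0 = 0 by apply: phi_inj; rewrite kapE rmorph0 raddf0.
pose g u := e (tofrac (rho u) / tofrac b).
pose U := undup [seq (w + v i)%MM | i <- enum 'I_N, w <- msupp (phi (c i))].
have termE i : c i *: e (m i) =
    \sum_(u <- U) kap (phi (c i * r i))@_u *: g u.
  have cE : c i = \sum_(w <- msupp (phi (c i))) kap (phi (c i))@_w * rho w.
    apply: phi_inj; rewrite rmorph_sum /= [LHS]mpolyE.
    rewrite big_seq [RHS]big_seq; apply: eq_bigr => w wc.
    by rewrite rmorphM kapE rhoE ?mul_mpolyC //; exists (c i).
  rewrite {1}cE scaler_suml.
  have -> : \sum_(u <- U) kap (phi (c i * r i))@_u *: g u =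
      \sum_(u <- msupp (phi (c i * r i))) kap (phi (c i * r i))@_u *: g u.
    rewrite [LHS](bigID (mem (msupp (phi (c i * r i))))) /= addrC big1 ?add0r.
      rewrite -big_filter; apply/perm_big/uniq_perm => [||u].
      - by rewrite filter_uniq ?undup_uniq.
      - exact: msupp_uniq.
      rewrite mem_filter andbC mem_undup.
      case: (boolP (u \in msupp _)) => [|_]; last by rewrite andbF.
      rewrite rmorphM rv (perm_mem (msuppMX _ _)) => /mapP[w wc ->].
      rewrite andbT; apply/allpairsPdep; exists i, w.
      by rewrite mem_enum addmC.
    by move=> u; rewrite mcoeff_msupp negbK => /eqP ->; rewrite kap0 scale0r.
  rewrite rmorphM rv (perm_big _ (msuppMX _ _)) [RHS]big_map /=.
  rewrite big_seq [RHS]big_seq; apply: eq_bigr => w wc.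
  have rhow : phi (rho w) = 'X_[w] by rewrite rhoE //; exists (c i).
  rewrite mcoeffMX -scalerA -eZ; [|exact: (mP i).1|]; last first.
    by apply: tofrac_mon; exists w.
  congr (_ *: e _); rewrite mE scale_fracE mulrA -tofracM; congr (tofrac _ / _).
  apply: phi_inj; rewrite rmorphM rhow rv -mpolyXD addmC rhoE //.
  exists (c i * r i); rewrite rmorphM rv (perm_mem (msuppMX _ _)).
  by apply/mapP; exists w.
rewrite zsum (eq_bigr _ (fun i _ => termE i)) exchange_big big1 //= => u _.
rewrite -scaler_suml -(big_morph kap kapD kap0) -raddf_sum -rmorph_sum rsum.
by rewrite rmorph0 raddf0 kap0 scale0r.
Qed.

Lemma graded_monomial_system : monomial_system frac_mon.
Proof.
split=> [m|m m'|m||].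
- move=> [a [b [am bm ->]]].
  by rewrite mulf_neq0 ?invr_eq0 ?tofrac_eq0 ?is_mon_neq0.
- move=> [a [b [am bm ->]]] [c [d [cm dm ->]]].
  exists (a * c), (b * d); split; [exact: is_monM | exact: is_monM |].
  by rewrite !tofracM invfM mulrACA.
- move=> [a [b [am bm ->]]]; exists b, a; split=> //.
  by rewrite invfM invrK mulrC.
- exact: frac_mon_nonunit.
- exact: graded_mon_free.
Qed.

End GradedSubalgebra.

(** * Maximal ideals and Noetherian modules *)

Section MaximalIdeals.
Variable A : comNzRingType.
Local Open Scope classical_set_scope.

(** Zorn's lemma, for the ideals that contain [x] but not 1. The empty set is
    added to them because it is the union of the empty chain. *)
Lemma exists_maximal_ideal (x : A) : (forall r, r * x != 1) ->
  exists2 m : idealr A, maximal_ideal m & x \in m.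
Proof.
move=> x1.
pose ideal (S : set A) := [/\ S x, ~ S 1 & forall r u v, S u -> S v -> S (r * u + v)].
pose P (S : set A) := S = set0 \/ ideal S.
have [S [PS maxS]] : exists S, P S /\ forall S', (S `<` S')%classic -> ~ P S'.
  apply: Zorn_bigcup => F FP Ftot.
  have [F0|[S FS [y Sy]]] : (forall S, F S -> S = set0) \/ exists2 S, F S & S !=set0.
    have [?|/existsNP[S /not_implyP[FS /eqP/set0P S0]]] := pselect (forall S, F S -> S = set0).
      by left.
    by right; exists S.
  - left; apply: bigcup0 => S; exact: F0.
  have idF T z : F T -> T z -> ideal T.
    by move=> FT Tz; have [T0|//] := FP T FT; rewrite T0 in Tz.
  right; split.
  - by exists S => //; have [] := idF _ _ FS Sy.
  - by move=> [T FT T1]; have [] := idF _ _ FT T1.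
  move=> r u v [T FT Tu] [T' FT' T'v].
  have [TT'|TT'] := Ftot _ _ FT FT'.
    by exists T' => //; have [_ _] := idF _ _ FT' T'v; apply=> //; apply: TT'.
  by exists T => //; have [_ _] := idF _ _ FT Tu; apply=> //; apply: TT'.
pose princ : set A := [set r * x | r in setT]%classic.
have idprinc : ideal princ.
  split; first by exists 1; rewrite ?mul1r.
    by move=> [r _ /eqP]; rewrite (negPf (x1 r)).
  by move=> r _ _ [u _ <-] [v _ <-]; exists (r * u + v); rewrite // mulrDl mulrA.
have [Sx S1 Slin] : ideal S.
  case: PS => // S0; have [] := maxS princ; last by right.
  have [princx _ _] := idprinc.
  by rewrite S0; split=> [? //|/(_ x princx)].
pose m : {pred A} := fun u => `[< S u >].
have mE u : u \in m <-> S u by split=> [/asboolP|/asboolP].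
have m_closed : idealr_closed m.
  split.
  - by apply/mE; rewrite -(subrr x) -[- x]mulN1r addrC; apply: Slin.
  - by apply/negP => /mE.
  - by move=> r u v /mE Su /mE Sv; apply/mE/Slin.
pose M : idealr A := HB.pack m (isIdealr.Build A m m_closed).
exists M; last exact/mE.
move=> I MI u; apply/idP/idP; last exact: MI.
move=> uI; apply: contrapT => uM.
apply: (maxS [set` I]%classic).
  split=> [y|SI].
    by move=> Sy; apply: MI; apply/mE.
  by apply/uM/mE/SI.
right; split.
- by apply: MI; apply/mE.
- by rewrite /= idealr1.
- by move=> r y z yI zI; rewrite /= rpredD // idealMr.
Qed.

End MaximalIdeals.

Section NoetherianModules.
Variable R : comNzRingType.
Hypothesis noethR : noetherian R.
Variable V : lmodType R.
Implicit Types (s : seq V) (N : submodClosed V) (r : R).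

Lemma span_seq_cons x s y : y \in span_seq (x :: s) ->
  exists r v, v \in span_seq s /\ y = r *: x + v.
Proof.
move: y; apply: span_seq_ind => [|c u y].
  by exists 0, 0; rewrite rpred0 scale0r addr0.
rewrite inE => /predU1P[->|us] [r [v [vs ->]]].
  by exists (c + r), v; rewrite scalerDl addrA.
by exists r, (c *: u + v); rewrite addrCA rpredD // rpredZ ?mem_span_seq.
Qed.

(** Induction on the generators [x :: s]: the coefficients of [x] in elements of
    [N] form an ideal, which is finitely generated. Lifts of generators of this
    ideal, together with generators of [N ∩ span s], generate [N]. *)
Lemma noetherian_submodule s N : {subset N <= span_seq s} -> fin_gen N.
Proof.
elim: s N => [|x s IHs] N Ns.
  exists [::] => y; apply/idP/idP; first exact: Ns.
  move: y; apply: span_seq_ind => [|r u v]; first exact: rpred0.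
  by rewrite in_nil.
pose A : {pred R^o} := fun r => `[< exists v, v \in span_seq s /\ (r : R) *: x + v \in N >].
have A_closed : submod_closed A.
  split=> [|c r r' /asboolP[v [vs vN]] /asboolP[v' [v's v'N]]]; apply/asboolP.
    by exists 0; rewrite scale0r addr0 !rpred0.
  exists (c *: v + v'); split; first by rewrite rpredD // rpredZ.
  have := rpredD (rpredZ (c : R) vN) v'N.
  by rewrite scalerDr scalerA addrACA -scalerDl.
pose AM : submodClosed R^o := HB.pack A (GRing.isSubmodClosed.Build R R^o A A_closed).
have [rs rsA] := noethR AM.
have /choice[w wP] : forall r : R, exists v, (r : R^o) \in rs ->
    v \in span_seq s /\ r *: x + v \in N.
  move=> r; have [rA|rA] := boolP ((r : R^o) \in A).
    by have /asboolP[v vP] := rA; exists v.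
  by exists 0 => /mem_span_seq; rewrite -rsA (negPf rA).
pose us := [seq r *: x + w r | r <- (rs : seq R)].
pose N' : {pred V} := [predI N & span_seq s].
have N'_closed : submod_closed N'.
  split=> [|c u v /andP[/= uN us'] /andP[/= vN vs]]; first by rewrite inE /= !rpred0.
  by rewrite inE /= !rpredD ?rpredZ.
pose NM : submodClosed V := HB.pack N' (GRing.isSubmodClosed.Build R V N' N'_closed).
have [ts tsN] : fin_gen NM by apply: IHs => v /andP[].
have usN : {subset us <= N}.
  by move=> _ /mapP[r rrs ->]; case: (wP r rrs).
have tsN' : {subset ts <= N}.
  by move=> v /mem_span_seq; rewrite -tsN => /andP[].
exists (us ++ ts) => y; apply/idP/idP; last first.
  by move: y; apply: span_seq_min => y; rewrite mem_cat => /orP[/usN|/tsN'].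
move=> yN; have [r [v [vs yE]]] := span_seq_cons (Ns y yN).
have uN : {subset span_seq us <= N} by apply: span_seq_min.
have rA : (r : R^o) \in span_seq rs.
  by rewrite -rsA; apply/asboolP; exists v; rewrite -yE.
have [u uus [v' v's uE]] : exists2 u, u \in span_seq us &
    exists2 v', v' \in span_seq s & u = r *: x + v'.
  elim/(span_seq_ind (s := rs)): r / rA {yE} => [|c r r' rrs [u uus [v' v's uE]]].
    by exists 0; rewrite ?rpred0 //; exists 0; rewrite ?rpred0 // scale0r addr0.
  exists (c *: (r *: x + w r) + u).
    by rewrite rpredD // rpredZ // mem_span_seq //; apply/mapP; exists r.
  exists (c *: w r + v'); first by rewrite rpredD // rpredZ; case: (wP r rrs).
  by rewrite uE scalerDl scalerDr scalerA addrACA.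
have : y - u \in NM.
  apply/andP; split; first by rewrite /= submodB // uN.
  by rewrite /= yE uE opprD addrACA subrr add0r submodB.
rewrite tsN => yu; rewrite -(subrK u y) rpredD //.
  by move: yu; apply: span_seq_min => t tt; apply: mem_span_seq; rewrite mem_cat tt orbT.
by move: uus; apply: span_seq_min => t tt; apply: mem_span_seq; rewrite mem_cat tt.
Qed.

(** A version of Nakayama's lemma. Divide [z0] repeatedly: [z_k = r *: z_(k+1)].
    The module spanned by all the [z_k] is finitely generated, hence spanned by
    one [z_K], and [z_(K+1) = c *: z_K = (c * r) *: z_(K+1)] gives [z_(K+1) =
    0]. *)
Lemma divisible_eq0 s N r : {subset N <= span_seq s} ->
  (forall c, exists d, d * (1 - c * r) = 1) ->
  (forall z, z \in N -> exists2 z', z' \in N & z = r *: z') ->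
  forall z, z \in N -> z = 0.
Proof.
move=> Ns rJ Nr z0 z0N.
have /choice[f fP] : forall z, exists z', z \in N -> z' \in N /\ z = r *: z'.
  move=> z; have [zN|_] := boolP (z \in N); last by exists z.
  by have [z'] := Nr z zN; exists z'.
pose z k := iter k f z0.
have zN k : z k \in N by elim: k => //= k /fP[].
have zS k : z k = r *: z k.+1 by case: (fP _ (zN k)).
have zD k j : z k = r ^+ j *: z (k + j)%N.
  elim: j => [|j ->]; first by rewrite expr0 scale1r addn0.
  by rewrite zS scalerA -exprSr addnS.
pose M := lspan (fun v => `[< exists k, v = z k >]).
have zM k : z k \in M by apply/mem_lspan/asboolP; exists k.
have [t tM] : fin_gen M.
  apply: (@noetherian_submodule s) => v vM; apply: Ns; move: v vM.
  by apply: lspan_min => _ /asboolP[k ->].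
have mulz K k : exists c, z K = c *: z (K + k)%N by exists (r ^+ k).
have Mz v : v \in M -> exists K c, v = c *: z K.
  move: v; apply: lspan_ind => [|c _ v /asboolP[k ->] [K [d ->]]].
    by exists 0%N, 0; rewrite scale0r.
  have [c1 ->] := mulz k K; have [c2 ->] := mulz K k.
  by exists (k + K)%N, (c * c1 + d * c2); rewrite addnC !scalerA scalerDl.
have [K KP] : exists K, forall v, v \in t -> exists c, v = c *: z K.
  have : {subset t <= M} by move=> v vt; rewrite tM mem_span_seq.
  elim: t {tM} => [|v t IHt] tM; first by exists 0%N.
  have [|K KP] := IHt; first by move=> u ut; rewrite tM // inE ut orbT.
  have [|K' [c vE]] := Mz v; first by rewrite tM // mem_head.
  exists (K + K')%N => u; rewrite inE => /predU1P[->|/KP[d ->]].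
    by have [c1 c1E] := mulz K' K; exists (c * c1); rewrite vE c1E addnC scalerA.
  by have [c1 ->] := mulz K K'; exists (d * c1); rewrite scalerA.
have [c cE] : exists c, z K.+1 = c *: z K.
  have := zM K.+1; rewrite tM; move: (z K.+1).
  apply: span_seq_ind => [|d u v /KP[c ->] [c' ->]]; first by exists 0; rewrite scale0r.
  by exists (d * c + c'); rewrite scalerDl scalerA.
have [d dE] := rJ c.
have zK0 : z K.+1 = 0.
  rewrite -[LHS]scale1r -dE -scalerA scalerBl scale1r -scalerA -zS -cE.
  by rewrite subrr scaler0.
by rewrite -[z0]/(z 0%N) (zD 0%N K.+1) add0n zK0 scaler0.
Qed.

End NoetherianModules.

(** * Local rings whose maximal ideal is generated by powers *)

Section PowerGenerated.
Variables (R : idomainType) (m : idealr R) (t : {fraction R}) (ns : seq nat).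
Local Notation K := {fraction R}.
Variable N : submodClosed K.
Implicit Types (r c : R).
(* [N] will be the image in [K] of a maximal ideal of the integral closure that
   contains [t]. *)
Hypothesis noethR : noetherian R.
Hypothesis m_rad : forall r, r \in m -> forall c, exists d, d * (1 - c * r) = 1.
Hypothesis m_powers : ideal_image m =i span_seq [seq t ^+ n | n <- ns].
Hypothesis m_neq0 : exists2 r, r \in m & r != 0.
Hypothesis N_proper : 1 \notin N.
Hypothesis tN : forall n, (0 < n)%N -> t ^+ n \in N.
Hypothesis Nm : forall r, tofrac r \in N -> r \in m.

Definition is_power (y : K) := exists z : int, y = t ^ z.

Let power_mem n : n \in ns -> exists2 r, r \in m & tofrac r = t ^+ n.
Proof.
move=> nns; have : t ^+ n \in ideal_image m.
  by rewrite m_powers mem_span_seq //; apply: map_f.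
by case/asboolP=> r rm ->; exists r.
Qed.

Let ns_gt0 n : n \in ns -> (0 < n)%N.
Proof.
case: n => // /power_mem[r rm /eqP]; rewrite expr0 -tofrac1 tofrac_eq => /eqP r1.
by rewrite r1 idealr1 in rm.
Qed.

Let t_neq0 : t != 0.
Proof.
have [r rm rn0] := m_neq0; apply: contraNneq rn0 => t0.
have : tofrac r \in ideal_image m by apply/asboolP; exists r.
rewrite m_powers -tofrac_eq0 => rspan; apply/eqP; move: rspan.
move: (tofrac r); apply: span_seq_ind => // c _ v /mapP[n nns ->] ->.
by rewrite t0 expr0n gtn_eqF ?ns_gt0 // scaler0 addr0.
Qed.

Let ns_neq0 : exists q, q \in ns.
Proof.
case: ns m_powers => [mE|q s _]; last by exists q; rewrite mem_head.
have [r rm rn0] := m_neq0; suff : tofrac r = 0 by move/eqP; rewrite tofrac_eq0 (negPf rn0).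
have : tofrac r \in ideal_image m by apply/asboolP; exists r.
by rewrite mE; move: (tofrac r); apply: span_seq_ind.
Qed.

(** A non-invertible power [t ^ z] in [R] has [z > 0]: for [z = 0] it is 1, and
    for [z < 0] it would put 1 in [N]. So all of them lie in [N]. *)
Lemma power_nonunit :
  1 \notin mspan (fun u => is_power u /\ exists2 r, u = tofrac r & r \isn't a GRing.unit).
Proof.
apply: contra N_proper; apply: mspan_min => _ [[[[|k]|k] ->] [r rE rU]].
- have r1 : r = 1 by apply/eqP; rewrite -tofrac_eq tofrac1 -rE expr0z.
  by rewrite r1 unitr1 in rU.
- by rewrite -exprnP tN.
- suff : 1 \in N by rewrite (negPf N_proper).
  have -> : 1 = r *: t ^+ k.+1.
    by rewrite scale_fracE -rE NegzE -exprnN mulVf // expf_neq0.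
  by rewrite rpredZ // tN.
Qed.

(** The numerical semigroup generated by [ns], with [c n] the multiplicity of
    [n]. The list is deduplicated so that multiplicities can be changed one
    generator at a time. *)
Definition in_semigroup k := exists c : nat -> nat, k = (\sum_(n <- undup ns) c n * n)%N.

Lemma semigroup0 : in_semigroup 0.
Proof. by exists (fun=> 0%N); rewrite big1. Qed.

Lemma sum_delta n k : n \in ns ->
  (\sum_(x <- undup ns) (if x == n then k else 0) * x = k * n)%N.
Proof.
move=> nns; rewrite (bigD1_seq n) ?mem_undup ?undup_uniq //= eqxx big1 ?addn0 //.
by move=> x /negPf ->.
Qed.

Lemma semigroupD n k : n \in ns -> in_semigroup k -> in_semigroup (n + k).
Proof.
move=> nns [c ->]; exists (fun x => (if x == n then 1 else 0) + c x)%N.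
under [RHS]eq_bigr do rewrite mulnDl.
by rewrite big_split /= sum_delta ?mul1n.
Qed.

(** In a large element some generator [n] is used at least [q] times. Trading
    [q] copies of [n] for [n] copies of [q] exhibits [q] as a summand. *)
Lemma semigroup_large q : q \in ns -> exists C, forall k, in_semigroup k -> (C <= k)%N ->
  exists2 k', in_semigroup k' & k = (q + k')%N.
Proof.
move=> qns; exists (\sum_(n <- undup ns) q * n).+1%N => k [c kE].
have [[n nns qc]|small] := pselect (exists2 n, n \in ns & (q <= c n)%N); last first.
  rewrite ltnNge kE => /negP[]; rewrite big_seq [leqRHS]big_seq.
  apply: leq_sum => n; rewrite mem_undup => nns.
  rewrite leq_mul2r; apply/orP; right; rewrite leqNgt; apply/negP => qc.
  by apply: small; exists n => //; apply: ltnW.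
move=> _.
pose c0 x := (if x == n then c x - q else c x)%N.
have kE0 : k = (\sum_(x <- undup ns) c0 x * x + q * n)%N.
  rewrite kE -(sum_delta q nns) -big_split /=; apply: eq_bigr => x _.
  by rewrite -mulnDl /c0; case: eqP => [->|_]; rewrite ?subnK ?addn0.
have n0 := ns_gt0 nns.
exists (\sum_(x <- undup ns) c0 x * x + n.-1 * q)%N.
  exists (fun x => c0 x + (if x == q then n.-1 else 0))%N.
  under [RHS]eq_bigr do rewrite mulnDl.
  by rewrite big_split /= sum_delta.
by rewrite kE0 addnCA -mulSn prednK // mulnC.
Qed.

Lemma semigroup_power k : in_semigroup k -> exists r, tofrac r = t ^+ k.
Proof.
move=> [c ->].
have /choice[r rE] : forall n, exists r, n \in ns -> tofrac r = t ^+ n.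
  move=> n; have [/power_mem[r _ rE]|nns] := boolP (n \in ns); first by exists r.
  by exists 0.
exists (\prod_(n <- undup ns) r n ^+ c n).
rewrite rmorph_prod expr_sum big_seq [RHS]big_seq; apply: eq_bigr => n.
by rewrite mem_undup => nns /=; rewrite tofracXn rE // mulnC exprM.
Qed.

Lemma int_lower_bound n (z : 'I_n -> int) :
  exists L (k : 'I_n -> nat), forall i, z i = L + (k i)%:Z.
Proof.
pose S := (\sum_i `|z i|)%N.
have zS i : 0 <= z i + S%:Z.
  have : (`|z i| <= S)%N by rewrite /S (bigD1 i) //= leq_addr.
  lia.
by exists (- S%:Z), (fun i => absz (z i + S%:Z)) => i; rewrite gez0_abs // addrC addrK.
Qed.

(** [W L] is spanned by the pairs [(e x, x)], where [x] ranges over the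
    multiples by semigroup powers of the given monomials, with exponent at least
    [L] relative to the common factor [b]. The claim [raise] is that a relation
    in [W L] lies in [W L.+1]: its coefficient at [t ^ L] is in [N], hence in
    [m], and is absorbed by the generators of [m]. For large [L], all elements
    of [W L] are divisible by [t ^ q] inside [W 0] ([divide]). So the values of
    [e] on relations form a finitely generated module divisible by an element of
    [m]. *)
Lemma power_free (T : lmodType R) (D : K -> Prop) (e : K -> T) :
  (forall x, D x -> is_power x) -> monomially_closed is_power D ->
  (forall r x, D x -> is_power (tofrac r) -> e (r *: x) = r *: e x) ->
  forall z, (z, 0) \in graph_span D e -> z = 0.
Proof.
move=> Dpow Dcl eZ z0 /lspanP[p [c [x [xD zE]]]].
have /choice[y yP] : forall i, exists y, D y /\ x i = (e y, y).
  by move=> i; have /asboolP[y] := xD i; exists y.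
have /choice[zy zyE] : forall i, exists z : int, y i = t ^ z.
  by move=> i; apply: Dpow; case: (yP i).
have [L0 [k0 kE]] := int_lower_bound zy.
pose b := t ^ L0.
have yE i : y i = b * t ^+ k0 i by rewrite zyE kE expfzDr.
pose Dk k := exists i g, in_semigroup g /\ k = (k0 i + g)%N.
pose gen k := (e (b * t ^+ k), b * t ^+ k).
have genM r g k : tofrac r = t ^+ g -> D (b * t ^+ k) -> r *: gen k = gen (g + k)%N.
  move=> rg Dk'.
  have rbt : r *: (b * t ^+ k) = b * t ^+ (g + k).
    by rewrite scale_fracE rg mulrCA -exprD.
  by rewrite /gen -rbt eZ //; exists g; rewrite rg.
have DkD k : Dk k -> D (b * t ^+ k).
  move=> [i [g [gg ->]]]; have [r rg] := semigroup_power gg.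
  have -> : b * t ^+ (k0 i + g) = r *: y i.
    by rewrite scale_fracE rg yE mulrCA -exprD addnC.
  by apply: Dcl; [case: (yP i) | exists g].
have DkS n k : n \in ns -> Dk k -> Dk (n + k)%N.
  move=> nns [i [g [gg ->]]]; exists i, (n + g)%N; split; first exact: semigroupD.
  by rewrite addnCA.
pose W L := lspan (fun w : T * K => `[< exists2 k, Dk k /\ (L <= k)%N & w = gen k >]).
have genW L k : Dk k -> (L <= k)%N -> gen k \in W L.
  by move=> Dkk Lk; apply/mem_lspan/asboolP; exists k.
have raise L z : (z, 0) \in W L -> (z, 0) \in W L.+1.
  have [DkL|nDkL] := pselect (Dk L); last first.
    apply: lspanS => w /asboolP[k [Dkk Lk] ->]; apply/asboolP; exists k => //.
    split=> //; rewrite ltn_neqAle Lk andbT; apply/eqP => Lk'.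
    by rewrite -Lk' in Dkk.
  have WL w : w \in W L -> exists d w', w' \in W L.+1 /\ w = d *: gen L + w'.
    move: w; apply: lspan_ind => [|r w w' /asboolP[k [Dkk Lk] ->] [d [v [vW ->]]]].
      by exists 0, 0; rewrite rpred0 scale0r addr0.
    have [->|kL] := eqVneq k L.
      by exists (r + d), v; rewrite scalerDl addrA.
    exists d, (r *: gen k + v); rewrite addrCA; split=> //.
    by rewrite rpredD // rpredZ // genW // ltn_neqAle eq_sym kL.
  have WN w : w \in W L.+1 -> exists2 v, v \in N & w.2 = b * t ^+ L * v.
    move: w; apply: lspan_ind => [|r w w' /asboolP[k [Dkk Lk] ->] [v vN /= ->]].
      by exists 0; rewrite ?rpred0 ?mulr0.
    exists (r *: t ^+ (k - L) + v).
      by rewrite rpredD // rpredZ // tN // subn_gt0.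
    by rewrite mulrDr scale_fracAr -[b * _ * t ^+ _]mulrA -exprD subnKC // ltnW.
  move=> /WL[d [w [wW zw]]]; have [v vN wv] := WN w wW.
  have bn0 : b * t ^+ L != 0 by rewrite mulf_neq0 ?expfz_neq0 ?expf_neq0.
  have dv : tofrac d = - v.
    apply/(mulfI bn0)/eqP; rewrite mulrN -subr_eq0 opprK -wv mulrC.
    by have /= <- := congr1 snd zw.
  have dm : d \in m by apply: Nm; rewrite dv -scaleN1r rpredZ.
  rewrite zw rpredD //.
  have : tofrac d \in ideal_image m by apply/asboolP; exists d.
  rewrite m_powers => dspan.
  suff [d' dd' d'W] : exists2 d', tofrac d = tofrac d' & d' *: gen L \in W L.+1.
    by move/eqP: dd'; rewrite tofrac_eq => /eqP ->.
  move: dspan; move: (tofrac d); apply: span_seq_ind => [|r u u' /mapP[n nns ->] [d' -> d'W]].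
    by exists 0; rewrite ?tofrac0 // scale0r rpred0.
  have [rn _ rnE] := power_mem nns.
  exists (r * rn + d'); first by rewrite tofracD tofracM rnE.
  rewrite scalerDl -scalerA rpredD // rpredZ // (genM _ _ _ rnE (DkD _ DkL)) //.
  by apply: genW; [apply: DkS | rewrite -[L.+1]add1n leq_add2r ns_gt0].
have raises k z : (z, 0) \in W 0%N -> (z, 0) \in W k.
  by move=> zW; elim: k => // k; apply: raise.
have [q qns] := ns_neq0; have [rq rqm rqE] := power_mem qns.
have [C CP] := semigroup_large qns.
have divide w : w \in W (\sum_i k0 i + C)%N -> exists2 w', w' \in W 0%N & w = rq *: w'.
  move: w; apply: lspan_ind => [|r w w' /asboolP[k [[i [g [gg kg]]] Lk] ->] [v vW ->]].
    by exists 0; rewrite ?rpred0 ?scaler0.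
  have Cg : (C <= g)%N.
    rewrite -(leq_add2l (k0 i)) -kg; apply: leq_trans Lk.
    by rewrite leq_add2r (bigD1 i) //= leq_addr.
  have [g' gg' gE] := CP g gg Cg.
  have Dkg' : Dk (k0 i + g')%N by exists i, g'.
  exists (r *: gen (k0 i + g')%N + v); first by rewrite rpredD // rpredZ // genW.
  rewrite scalerDr scalerA mulrC -scalerA (genM _ _ _ rqE (DkD _ Dkg')).
  by rewrite kg gE addnCA.
pose M : {pred T} := fun z => (z, 0) \in W 0%N.
have M_closed : submod_closed M.
  split=> [|r u v uM vM]; first exact: rpred0.
  rewrite -[_ \in M]/(_ \in W 0%N).
  rewrite (_ : (_, _) = r *: (u, 0) + (v, 0)); first by rewrite rpredD // rpredZ.
  by congr (_, _); rewrite /= scaler0 addr0.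
pose MM : submodClosed T := HB.pack M (GRing.isSubmodClosed.Build R T M M_closed).
apply: (divisible_eq0 noethR (s := [seq e (y i) | i <- enum 'I_p]) (N := MM) (r := rq)).
- move=> z zM; have : (z, 0) \in W 0%N by [].
  rewrite -[z in _ -> z \in _]/(z, 0 : K).1; move: (z, 0).
  apply: lspan_ind => [|r w w' /asboolP[k [[i [g [gg ->]]] _] ->] w'M]; first exact: rpred0.
  rewrite rpredD //= rpredZ //.
  have [rg rgE] := semigroup_power gg.
  have -> : e (b * t ^+ (k0 i + g)) = rg *: e (y i).
    rewrite -eZ; [|by case: (yP i)|by exists g].
    by rewrite scale_fracE rgE yE mulrCA -exprD addnC.
  by rewrite rpredZ // mem_span_seq //; apply: map_f; rewrite mem_enum.
- exact: m_rad.
- move=> z zM; have [[z' x'] zW' [zE' /eqP]] := divide _ (raises _ _ zM).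
  rewrite eq_sym scale_fracE mulf_eq0 rqE expf_eq0 (negPf t_neq0) andbF /= => /eqP x'0.
  by exists z' => //; move: zW'; rewrite x'0.
- rewrite -[_ \in _]/(_ \in W 0%N) zE rpred_sum // => i _.
  rewrite rpredZ // (yP i).2 yE; apply: genW => //.
  by exists i, 0%N; split; [apply: semigroup0 | rewrite addn0].
Qed.

Lemma power_monomial_system : monomial_system is_power.
Proof.
split=> [_ [z ->]|_ _ [z ->] [z' ->]|_ [z ->]||].
- exact: expfz_neq0.
- by exists (z + z'); rewrite expfzDr.
- by exists (- z); rewrite -invr_expz.
- exact: power_nonunit.
- exact: power_free.
Qed.

End PowerGenerated.


Section LocalRing.
Variables (R : idomainType) (m : idealr R) (t : int_closure R).
Local Notation K := {fraction R}.
Hypothesis local_m : local_ring m.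
Hypothesis dim1 : krull_dim_eq R 1.
Hypothesis resm : residually_rational m.
Hypothesis gen_m : generated_by_powers m t.
Implicit Types (r : R).

Lemma quot_pi_eq0 (A : comNzRingType) (n : idealr A) (x : A) :
  (\pi_{ideal_quot n} x == 0 :> {ideal_quot n}) = (x \in n).
Proof. by rewrite -[x in RHS]subr0 Quotient.idealrBE -(raddf0 \pi_{ideal_quot n}). Qed.

(** A non-invertible element lies in some maximal ideal, and [m] is the only
    one. *)
Lemma local_nonunit r : (forall c, c * r != 1) -> r \in m.
Proof.
move=> /exists_maximal_ideal[m' m'max rm'].
by have [_ _ /(_ m' m'max) <-] := local_m.
Qed.

Lemma local_rad r : r \in m -> forall c, exists d, d * (1 - c * r) = 1.
Proof.
move=> rm c; apply: contrapT => nd.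
have : 1 - c * r \in m.
  by apply: local_nonunit => d; apply/eqP => d1; apply: nd; exists d.
move=> /(rpredD (idealMr c rm)).
by rewrite addrC subrK idealr1.
Qed.

Lemma local_dim1_neq0 : exists2 r, r \in m & r != 0.
Proof.
have [[P PP] _] := dim1.
have [_ /existsNP[x /not_implyP[x1 x0]]] := PP ord0 ord_max isT.
exists x; last by apply: contra_not_neq x0 => ->; exact: rpred0.
apply: local_nonunit => c; apply: contraTneq isT => c1.
by have := idealMr c x1; rewrite c1 idealr1.
Qed.

(** Every maximal ideal of the integral closure lies over [m], because the map
    of residue fields is well defined and injective. *)
Lemma maximal_int_closure (n : idealr (int_closure R)) r :
  maximal_ideal n -> (to_int_closure r \in n) = (r \in m).
Proof.
move=> /resm[f fbij fE]; rewrite -!quot_pi_eq0 -fE.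
by rewrite -(inj_eq (bij_inj fbij)) rmorph0.
Qed.

Lemma val_exp k : val (t ^+ k) = val t ^+ k.
Proof. exact: (rmorphXn (val : int_closure R -> K)). Qed.

(** A power [t ^ q] lies in [m], hence in a maximal ideal of the integral
    closure; so [t] is not invertible there and belongs to some maximal ideal
    [n], whose image in [K] is used as [N]. *)
Lemma local_power_monomial_system : monomial_system (is_power (val t)).
Proof.
have [ns nsE] := gen_m.
have [n0 n0max _] : exists2 n : idealr (int_closure R), maximal_ideal n & 0 \in n.
  by apply: exists_maximal_ideal => r; rewrite mulr0 eq_sym oner_eq0.
have [r0 r0m r0n0] := local_dim1_neq0.
have [q [qns [rq rqm rqE]]] : exists q, q \in ns /\ exists2 r, r \in m & tofrac r = val t ^+ q.
  case: ns nsE => [|q s] sE.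
    suff : tofrac r0 = 0 by move/eqP; rewrite tofrac_eq0 (negPf r0n0).
    have : tofrac r0 \in ideal_image m by apply/asboolP; exists r0.
    by rewrite sE; move: (tofrac r0); apply: span_seq_ind.
  exists q; split; first by rewrite mem_head.
  have /asboolP[r rm ->] : val t ^+ q \in ideal_image m.
    by rewrite sE mem_span_seq //= mem_head.
  by exists r.
have tq : t ^+ q = to_int_closure rq by apply: val_inj; rewrite val_exp -rqE.
have [n nmax tn] : exists2 n : idealr (int_closure R), maximal_ideal n & t \in n.
  apply: exists_maximal_ideal => s; apply: contraTneq isT => st.
  have : t ^+ q \in n0 by rewrite tq maximal_int_closure.
  by move=> /(idealMr (s ^+ q)); rewrite -exprMn st expr1n idealr1.
pose N : {pred K} := fun x => `[< exists2 v, v \in n & x = val v >].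
have N_closed : submod_closed N.
  split=> [|r x y /asboolP[u un ->] /asboolP[v vn ->]]; apply/asboolP.
    by exists 0; rewrite ?rpred0.
  exists (to_int_closure r * u + v); last by [].
  by rewrite rpredD // idealMr.
pose NM : submodClosed K := HB.pack N (GRing.isSubmodClosed.Build R K N N_closed).
have val_n v : val v \in NM -> v \in n.
  by case/asboolP=> u un /val_inj ->.
apply: (power_monomial_system (m := m) (ns := ns) (N := NM)) => //.
- by case: local_m.
- exact: local_rad.
- by exists r0.
- by apply/negP => /(val_n 1); rewrite idealr1.
- move=> k k0; apply/asboolP; exists (t ^+ k); last by rewrite val_exp.
  by rewrite -(prednK k0) exprSr idealMr.
- move=> r; rewrite -[tofrac r]/(val (to_int_closure r)) => /val_n.
  by rewrite maximal_int_closure.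
Qed.

End LocalRing.

Theorem theorem1p4 (R : idomainType) (mon : {fraction R} -> Prop)
  (setting :
     (exists (k : fieldType) (n : nat) (phi : {rmorphism R -> {mpoly k[n]}}),
        standard_graded_subalgebra phi
        /\ (forall y, mon y <-> x_monomial phi y))
     \/
     (exists (m : idealr R) (t : int_closure R),
        [/\ local_ring m, krull_dim_eq R 1,
            analytically_irreducible m, residually_rational m
          & generated_by_powers m t]
        /\ (forall y, mon y <-> t_monomial t y)))
  (I J : submodClosed {fraction R})
  (I_neq0 : exists2 x, x \in I & x != 0)
  (J_neq0 : exists2 x, x \in J & x != 0)
  (h : nat) (a : 'I_h -> {fraction R})
  (a_monomial : forall i, mon (a i))
  (I_gen : I =i span_seq [seq a i | i : 'I_h])
  (J_monomial : monomial_frac_ideal mon J) :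
  [<-> torsion (tensor (submod_type I) (submod_type J)) =i pred1 0;
       forall P Q : submodClosed {fraction R},
         fin_gen P -> fin_gen Q -> addmod P Q =i I ->
         mulmod [predI P & Q] J =i [predI mulmod P J & mulmod Q J];
       forall S : {set 'I_h},
         mulmod [predI span_seq [seq a i | i in S]
                     & span_seq [seq a j | j in ~: S]] J
         =i [predI mulmod (span_seq [seq a i | i in S]) J
                 & mulmod (span_seq [seq a j | j in ~: S]) J]].
Proof.
have [G monG monGP] : exists2 G, monomial_system G & forall y, mon y -> G y.
  case: setting => [[k [n [phi [phi_graded monE]]]]|[m [t [[lm dm _ rm gm] monE]]]].
    exists (frac_mon phi); first exact: graded_monomial_system.
    by move=> y /monE; apply: x_monomial_frac_mon.
  by exists (is_power (val t)) => [|y /monE //]; apply: (local_power_monomial_system lm).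
have [mu muE] := tensor_mul I J.
have inj_tors := torsion0_mul_inj muE I_neq0.
tfae.
- move=> /inj_tors inj P Q _ _ PQI.
  exact: (mul_inj_capM muE inj PQI).
- move=> cap S; apply: cap; [by eexists | by eexists |].
  move=> x; rewrite I_gen; apply/idP/idP.
    case/asboolP=> y [z [yS zS ->]].
    apply: rpredD; [move: y yS | move: z zS]; apply: span_seq_min => _ /fintype.imageP[i _ ->];
      by apply: mem_span_seq; apply/fintype.imageP; exists i.
  move: x; apply: span_seq_ind => [|r _ x /fintype.imageP[i _ ->] /asboolP[y [z [yS zS ->]]]]; apply/asboolP.
    by exists 0, 0; rewrite !rpred0 addr0.
  have [iS|iS] := boolP (i \in S).
    exists (r *: a i + y), z; rewrite addrA; split=> //.
    rewrite rpredD // rpredZ // mem_span_seq //; apply/fintype.imageP; by exists i.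
  exists y, (r *: a i + z); rewrite addrCA; split=> //.
  rewrite rpredD // rpredZ // mem_span_seq //; apply/fintype.imageP; exists i => //.
  by rewrite inE.
move=> capS; apply/inj_tors.
have [s [smon J_gen]] := J_monomial.
apply: (capM_mul_inj monG (a := a) (s := s)) => //.
- by move=> i; apply/monGP.
- by move=> b /smon/monGP.
Qed.
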